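(* Let $d\ge 2$, $\kappa>0$, let $\psi_0(x)=e^{ikx}$ with $k\in\mathbb{R}^d$, $|k|=\kappa$, be a plane wave, and let $\psi_1$ be a radiation solution of the Helmholtz equation $-\Delta\psi=\kappa^2\psi$ in $\mathcal{U}$, with far-field pattern $f_1$. Let $X=X_{s,\omega}$ with $\omega\in\mathbb{S}^{d-1}$ fixed and $s$ sufficiently large so that $X\subset\mathcal{U}$. Then $f_1$ on $\mathbb{S}^+_\omega$ is approximately determined by the intensity $|\psi_0+\psi_1|^2$ on $X$ via the following two-point formula. For fixed $k$ and fixed $\theta\in\mathbb{S}^+_\omega$, with $$x=\frac{s\theta}{(\theta,\omega)}\in X,\qquad y=x+\zeta\in X,\qquad \zeta\in X_{0,\omega},$$ and with $D=D(x,\zeta,k)=2i\sin\big(k\zeta+|k||x|-|k||y|\big)$ assumed to satisfy $D\ne 0$, one has $$f_1(\theta)=f_{1,1}(\theta)+\frac1D\left(\mathcal{O}\left(\frac{1}{|x|^{\sigma}}\right)+\mathcal{O}\left(\frac{|\zeta|}{|x|}\right)\right)\quad\text{as } |x|\to+\infty \text{ and } |x|/|\zeta|\to+\infty,$$ where $$f_{1,1}(\theta):=\frac1D\left(e^{i(ky-|k||y|)}a(x,k)-e^{i(kx-|k||x|)}a(y,k)\right),$$ and $\sigma=1/2$ for $d=2$, $\sigma=1$ for $d\ge 3$.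
   Context: $\mathcal{U}=\mathbb{R}^d\setminus(\Omega\cup\partial\Omega)$ is connected, where $\Omega\subset\mathbb{R}^d$ is a bounded open domain with smooth boundary. For vectors, $kx=(k,x)$ denotes the Euclidean scalar product. A radiation solution is a $C^2$ solution $\psi_1$ of $-\Delta\psi_1=\kappa^2\psi_1$ in $\mathcal{U}$ satisfying the Sommerfeld condition $|x|^{\frac{d-1}{2}}\left(\frac{\partial}{\partial|x|}-i\kappa\right)\psi_1(x)\to0$ as $|x|\to+\infty$, uniformly in $x/|x|$. Its far-field pattern is the function $f_1$ on $\mathbb{S}^{d-1}$ such that $$\psi_1(x)=\frac{e^{i\kappa|x|}}{|x|^{\frac{d-1}{2}}}f_1\left(\frac{x}{|x|}\right)+\mathcal{O}\left(\frac{1}{|x|^{\frac{d+1}{2}}}\right),\quad |x|\to+\infty.$$ For $s\ge0$, $\omega\in\mathbb{S}^{d-1}$: $X_{s,\omega}=\{x\in\mathbb{R}^d:(x,\omega)=s\}$ and $\mathbb{S}^+_\omega=\{\theta\in\mathbb{S}^{d-1}:(\theta,\omega)>0\}$. The holographic data enter through $a(x,k)=|x|^{(d-1)/2}\left(|\psi_0(x)+\psi_1(x)|^2-1\right)$, $x\in\mathcal{U}$. Note that for $x=s\theta/(\theta,\omega)$ one has $x/|x|=\theta$ and $|x|=s/(\theta,\omega)$, so $|x|\to+\infty$ for fixed $\theta$ means $s\to+\infty$; $f_{1,1}(\theta)$ depends also on $x,\zeta,k$. Convention: ''as $|x|\to+\infty$ and $|x|/|\zeta|\to+\infty$'' means that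 there are constants $C,R>0$ (depending on the fixed quantities only) such that the $\mathcal{O}$ bounds hold with constant $C$ whenever $|x|\ge R$ and $|x|/|\zeta|\ge R$; $\frac1D(\mathcal{O}(g)+\mathcal{O}(h))$ denotes $\frac1D$ times such terms. *)

(* Defs.v *)
From HB Require Import structures.
From mathcomp Require Import all_boot all_order all_algebra.
From mathcomp Require Import complex.
From mathcomp Require Import all_classical all_reals all_analysis.

Set Implicit Arguments.
Unset Strict Implicit.
Unset Printing Implicit Defensive.

Import Order.TTheory GRing.Theory Num.Theory.
Import numFieldNormedType.Exports.

Local Open Scope classical_set_scope.
Local Open Scope ring_scope.

Section Euclidean.
Context {R : realType} {d : nat}.
Implicit Types x y w : 'rV[R]_d.

(* The norm `|x| of the library on 'rV[R]_d is the sup norm; it is used here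
   only through the topology and the bornology it induces. *)
Definition dot x y : R := \sum_(i < d) x 0 i * y 0 i.

Definition enorm x : R := Num.sqrt (dot x x).

Definition sphere : set 'rV[R]_d := [set x | enorm x = 1].

Definition half_sphere w : set 'rV[R]_d := [set t | sphere t /\ 0 < dot t w].

Definition hyperplane (s : R) w : set 'rV[R]_d := [set x | dot x w = s].

Definition partial (i : 'I_d) (f : 'rV[R]_d -> R) (x : 'rV[R]_d) : R :=
  'D_('e_i) f x.

(* Class C^n on A, by iterated partial derivatives; only meant for open A. *)
Fixpoint Ck (n : nat) (A : set 'rV[R]_d) (f : 'rV[R]_d -> R) : Prop :=
  (forall x, A x -> {for x, continuous f}) /\
  if n is m.+1 then
    forall i : 'I_d,
      (forall x, A x -> derivable f x ('e_i)) /\ Ck m A (partial i f)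
  else True.

Definition boundary (A : set 'rV[R]_d) : set 'rV[R]_d :=
  closure A `&` closure (~` A).

(* Smoothness (C^oo) of the boundary: locally, A is the negativity set of a
   smooth function whose gradient does not vanish at the boundary point, so
   that A lies on one side of its boundary, a smooth hypersurface. *)
Definition smooth_boundary (A : set 'rV[R]_d) : Prop :=
  forall p, boundary A p ->
    exists (V : set 'rV[R]_d) (rho : 'rV[R]_d -> R),
      [/\ open V /\ V p,
          forall n, Ck n V rho,
          exists i : 'I_d, partial i rho p != 0
        & forall x, V x -> (A x <-> rho x < 0)].

Definition smooth_bounded_domain (A : set 'rV[R]_d) : Prop :=
  [/\ open A, A !=set0, connected A, bounded_set A & smooth_boundary A].

Definition exterior (A : set 'rV[R]_d) : set 'rV[R]_d := ~` (A `|` boundary A).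

End Euclidean.

Section Helmholtz.
Context {R : realType} {d : nat}.
Implicit Types (x y z k : 'rV[R]_d) (psi : 'rV[R]_d -> R[i]).

Definition imI : R[i] := (0 +i* 1)%C.

Definition expi (t : R) : R[i] := (cos t +i* sin t)%C.

Definition cmod (z : R[i]) : R := Normc.normc z.

Definition RePart psi : 'rV[R]_d -> R := fun x => complex.Re (psi x).
Definition ImPart psi : 'rV[R]_d -> R := fun x => complex.Im (psi x).

(* The library has no R-linear differentiation of R[i]-valued maps:
   derivatives are taken on the real and imaginary parts. *)
Definition derivC v psi x : R[i] := ('D_v (RePart psi) x +i* 'D_v (ImPart psi) x)%C.

Definition CkC (n : nat) (A : set 'rV[R]_d) psi : Prop :=
  Ck n A (RePart psi) /\ Ck n A (ImPart psi).

Definition laplacian psi x : R[i] :=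
  \sum_(i < d) derivC ('e_i) (derivC ('e_i) psi) x.

Definition radial_deriv psi x : R[i] := derivC ((enorm x)^-1 *: x) psi x.

Definition sommerfeld (kappa : R) (U : set 'rV[R]_d) psi : Prop :=
  forall e : R, 0 < e -> exists2 r : R, 0 < r &
    forall x, U x -> r <= enorm x ->
      cmod ((enorm x `^ ((d%:R - 1) / 2))%:C
            * (radial_deriv psi x - imI * kappa%:C * psi x))%C < e.

Definition radiation_solution (kappa : R) (U : set 'rV[R]_d) psi : Prop :=
  [/\ CkC 2 U psi,
      forall x, U x -> - laplacian psi x = (kappa ^+ 2)%:C%C * psi x
    & sommerfeld kappa U psi].

(* f is only relevant on the unit sphere. *)
Definition far_field_pattern (kappa : R) (U : set 'rV[R]_d) psi
    (f : 'rV[R]_d -> R[i]) : Prop :=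
  exists C r : R, [/\ 0 < C, 0 < r &
    forall x, U x -> r <= enorm x ->
      cmod (psi x - expi (kappa * enorm x)
                    / (enorm x `^ ((d%:R - 1) / 2))%:C%C
                    * f ((enorm x)^-1 *: x))
      <= C / enorm x `^ ((d%:R + 1) / 2)].

Definition plane_wave k x : R[i] := expi (dot k x).

Definition intensity psi0 psi1 x : R := cmod (psi0 x + psi1 x) ^+ 2.

Definition holographic_data psi1 x k : R :=
  enorm x `^ ((d%:R - 1) / 2) * (intensity (plane_wave k) psi1 x - 1).

Definition Dfun x z k : R[i] :=
  (2 * imI * (sin (dot k z + enorm k * enorm x - enorm k * enorm (x + z)))%:C)%C.

Definition f11 psi1 x z k : R[i] :=
  let y := x + z in
  (Dfun x z k)^-1
  * (expi (dot k y - enorm k * enorm y) * (holographic_data psi1 x k)%:C%C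
     - expi (dot k x - enorm k * enorm x) * (holographic_data psi1 y k)%:C%C).

End Helmholtz.

Definition sigma (R : realType) (d : nat) : R := if d == 2 then 2^-1 else 1.

(* Main.v *)
Require Import Defs.
From HB Require Import structures.
From mathcomp Require Import all_boot all_order all_algebra.
From mathcomp Require Import complex.
From mathcomp Require Import all_classical all_reals all_analysis.
From mathcomp Require Import ring lra.

(* Only local information on the far field is needed: the two-point formula is
   linear algebra in f1 and its conjugate, once f1 is known to be Lipschitz at
   theta.  With mu = (d - 1) / 2, the dilated and conjugated field
     h(tau, x) = tau^mu exp(-i kappa tau |x|) psi1(tau x)
   converges at rate 1 / tau to |x|^-mu f1(x / |x|) near theta, and the Helmholtz
   equation becomes exactly  Laplacian_x h = - (2 i kappa tau^2 / |x|) dh/dtau.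
   Averaging h over tau in [T, 2 T] with weight (T / tau)^2 turns the right-hand
   side into h(T, x) - h(2 T, x) times T, which is bounded uniformly in T.  So the
   limit is a uniform limit of functions with bounded Laplacian, and the reflection
   and barrier proof of the gradient estimate for the Poisson equation shows that
   it is Lipschitz.  Averages are Riemann sums, and Laplacians are limits of
   symmetric second differences, so no integration is used. *)

Set Implicit Arguments.
Unset Strict Implicit.
Unset Printing Implicit Defensive.

Import Order.TTheory GRing.Theory Num.Theory.
Import numFieldNormedType.Exports.

Local Open Scope classical_set_scope.
Local Open Scope ring_scope.

(** * Coordinates and the sup norm *)

(** The far-field pattern is defined by a pointwise asymptotic, which carries no regularity of [f1],
    whereas the two-point formula replaces its value at y/|y| by its value at theta, with an error
    of order |zeta|/|x|. A Lipschitz estimate at theta is exactly what this costs, and it is the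
    analytic content of the proof. The obstacle is that the asymptotic controls the values of h at
    each tau but not dh/dtau, so that no single dilate has a Laplacian with a usable bound;
    averaging replaces the derivative by an increment, which the asymptotic does control. The factor
    i in the equation couples real and imaginary parts: the Laplacian of each is a multiple of the
    tau-derivative of the other. The limit theorem is therefore stated for a real pair p, q and
    applied to (Re, Im) and to (Im, -Re). *)

Lemma continuous_at_id {T : topologicalType} (x : T) : {for x, continuous id}.
Proof. by rewrite /prop_for /continuous_at; exact: cvg_id. Qed.

Lemma continuous_at_sum {R : realType} {T : topologicalType} n
    (f : 'I_n -> T -> R) (x : T) : (forall i, {for x, continuous (f i)}) ->
  {for x, continuous (fun z => \sum_(i < n) f i z)}.
Proof.
move=> fc.
suff H g : (forall z, g z = \sum_(i < n) f i z) -> {for x, continuous g}.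
  exact: H.
elim: n f fc g => [f fc|n IH f fc] g /funext gE.
  have {gE} -> : g = fun=> 0 by rewrite gE; apply/funext => z; rewrite big_ord0.
  exact: cst_continuous.
have {gE} -> : g = (fun z => \sum_(i < n) f (widen_ord (leqnSn n) i) z) + f ord_max.
  by rewrite gE; apply/funext => z; rewrite big_ord_recr.
by apply: continuousD; [apply: (IH (fun i => f (widen_ord (leqnSn n) i))) | exact: fc].
Qed.

Section SupNorm.
Context {R : realType} {d : nat}.
Implicit Types (x y p : 'rV[R]_d).

Lemma coord_le_norm x i : `|x 0 i| <= `|x|.
Proof.
rewrite [leRHS]/Num.Def.normr/= mx_normrE.
by apply/bigmax_geP; right => /=; exists (0, i).
Qed.

Lemma norm_le_coord x (e : R) : 0 <= e -> (forall i, `|x 0 i| <= e) -> `|x| <= e.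
Proof.
move=> e0 xe; rewrite [leLHS]/Num.Def.normr/= mx_normrE.
by apply: bigmax_le => // -[i j] _ /=; rewrite ord1.
Qed.

(** Corners of a path from x to y that moves one coordinate at a time, so that only partial
    derivatives occur along it. *)
Definition mix k x y : 'rV[R]_d := \row_j (if (j < k)%N then y 0 j else x 0 j).

Lemma mix0 x y : mix 0 x y = x.
Proof. by apply/rowP => j; rewrite !mxE. Qed.

Lemma mixd x y : mix d x y = y.
Proof. by apply/rowP => j; rewrite !mxE ltn_ord. Qed.

Lemma mixS x y (i : 'I_d) :
  mix i.+1 x y = mix i x y + (y 0 i - x 0 i) *: 'e_i.
Proof.
apply/rowP => j; rewrite !mxE eqxx /= ltnS leq_eqVlt.
have [->|ji] := eqVneq j i.
  by rewrite eqxx /= ltnn mulr1 addrC subrK.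
by rewrite mulr0 addr0 (inj_eq val_inj) (negPf ji).
Qed.

Lemma mix_telescope (w : 'rV[R]_d -> R) x y :
  w y - w x = \sum_(i < d) (w (mix i x y + (y 0 i - x 0 i) *: 'e_i) - w (mix i x y)).
Proof.
under eq_bigr do rewrite -mixS.
by rewrite -(big_mkord xpredT (fun k => w (mix k.+1 x y) - w (mix k x y)))
  telescope_sumr // mix0 mixd.
Qed.

(** Each coordinate of a point of the path lies between those of x and y, and sup-norm balls are
    products of intervals. *)
Lemma mix_segment_near p x y (c : R) (i : 'I_d) (e : R) :
  `|x - p| <= e -> `|y - p| <= e -> 0 <= c <= 1 ->
  `|mix i x y + (c * (y 0 i - x 0 i)) *: 'e_i - p| <= e.
Proof.
move=> xp yp /andP[c0 c1].
have e0 : 0 <= e by exact: le_trans xp.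
apply: norm_le_coord => // j; rewrite !mxE eqxx /=.
have hx : `|x 0 j - p 0 j| <= e.
  by apply: le_trans xp; move: (coord_le_norm (x - p) j); rewrite !mxE.
have hy : `|y 0 j - p 0 j| <= e.
  by apply: le_trans yp; move: (coord_le_norm (y - p) j); rewrite !mxE.
have [ji|ji] := eqVneq j i.
  subst j; rewrite ltnn /= mulr1.
  move: hx hy; rewrite !ler_norml => /andP[? ?] /andP[? ?].
  by apply/andP; split; nra.
by rewrite mulr0 addr0; case: ifP.
Qed.

End SupNorm.

(** * Gradient estimate for the Poisson equation *)

Section PoissonGradient.
Context {R : realType} {d : nat}.
Implicit Types (x y p : 'rV[R]_d) (w : 'rV[R]_d -> R) (t F M rho s : R).

(** Left undivided by t^2: a Laplacian bound reads |symlap| <= F t^2 for small t > 0, which makes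
    sense for a function that is merely continuous. *)
Definition symlap w t x : R :=
  \sum_(k < d) (w (x + t *: 'e_k) + w (x - t *: 'e_k) - 2 * w x).

Lemma symlapB w1 w2 t x :
  symlap (fun z => w1 z - w2 z) t x = symlap w1 t x - symlap w2 t x.
Proof. by rewrite /symlap -sumrB; apply: eq_bigr => k _; ring. Qed.

Lemma symlapZ c w t x : symlap (fun z => c * w z) t x = c * symlap w t x.
Proof. by rewrite /symlap mulr_sumr; apply: eq_bigr => k _; ring. Qed.

Definition mirror p i x := x - (2 * (x 0 i - p 0 i)) *: 'e_i.

Lemma mirrorE p i x j :
  mirror p i x 0 j = if j == i then 2 * p 0 i - x 0 i else x 0 j.
Proof.
rewrite !mxE eqxx /=; case: eqVneq => [->|_] /=; first by rewrite mulr1; ring.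
by rewrite mulr0 subr0.
Qed.

(** The reflection swaps the two difference points in direction i and commutes with the steps in all
    other directions. *)
Lemma symlap_mirror w p i t x :
  symlap (w \o mirror p i) t x = symlap w t (mirror p i x).
Proof.
rewrite /symlap; apply: eq_bigr => k _ /=.
have [->|ki] := eqVneq k i.
  have -> : mirror p i (x + t *: 'e_i) = mirror p i x - t *: 'e_i.
    apply/rowP => j; rewrite mirrorE !mxE mulrDr mulrN; do ?rewrite eqxx /=.
    by case: eqVneq => [->|_] /=; ring.
  have -> : mirror p i (x - t *: 'e_i) = mirror p i x + t *: 'e_i.
    apply/rowP => j; rewrite mirrorE !mxE; do ?rewrite eqxx /=.
    by case: eqVneq => [->|_] /=; ring.
  by ring.
have ik : (i == k) = false by rewrite eq_sym; exact/negbTE.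
have E c : mirror p i (x + c *: 'e_k) = mirror p i x + c *: 'e_k.
  apply/rowP => j; rewrite mirrorE [RHS]mxE mirrorE !mxE !eqxx ik /=.
  by case: eqVneq => [->|_] //; rewrite ik /=; ring.
by rewrite -scaleNr !E scaleNr.
Qed.

Lemma mirror_dist p i x : `|mirror p i x - p| <= `|x - p|.
Proof.
apply: norm_le_coord => // j; rewrite mxE mirrorE mxE.
have := coord_le_norm (x - p) j; rewrite !mxE.
by case: eqVneq => [->|//]; rewrite -(normrN (x 0 i - p 0 i)); congr (`|_| <= _); ring.
Qed.

Lemma continuous_mirror p i x : {for x, continuous (mirror p i)}.
Proof.
apply: continuousB; first exact: continuous_at_id.
apply: continuousZr_tmp; apply: continuousM; first exact: cst_continuous.
by apply: continuousB; [exact: coord_continuous | exact: cst_continuous].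
Qed.

(* The comparison function of Gilbarg and Trudinger, section 3.4 *)
Definition barrier M N rho p i x : R :=
  (M / rho ^+ 2) * (\sum_(j < d) (x 0 j - p 0 j) ^+ 2
     - d%:R * (x 0 i - p 0 i) ^+ 2 + d%:R * rho * (x 0 i - p 0 i))
  + (N / 2) * ((x 0 i - p 0 i) * (rho - (x 0 i - p 0 i))).

(** Second differences of quadratics are exact for every t. The sum of squares and d times the i-th
    square cancel, affine terms contribute nothing, and the last product yields -N t^2. *)
Lemma symlap_barrier M N rho p i t x :
  symlap (barrier M N rho p i) t x = - N * t ^+ 2.
Proof.
have S c k : \sum_(j < d) ((x + c *: 'e_k) 0 j - p 0 j) ^+ 2 =
   \sum_(j < d) (x 0 j - p 0 j) ^+ 2 + 2 * c * (x 0 k - p 0 k) + c ^+ 2.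
  rewrite (bigD1 k) //= [in RHS](bigD1 k) //= !mxE !eqxx /=.
  rewrite (eq_bigr (fun j => (x 0 j - p 0 j) ^+ 2)); first by ring.
  by move=> j jk; rewrite !mxE eqxx (negPf jk) /= mulr0 addr0.
rewrite /symlap /barrier.
under eq_bigr => k _ do rewrite -(scaleNr t 'e_k) !S.
rewrite (eq_bigr (fun k => (M / rho ^+ 2) * (2 * t ^+ 2)
   - (k == i)%:R * ((M / rho ^+ 2) * d%:R * 2 * t ^+ 2 + N * t ^+ 2))).
  rewrite sumrB sumr_const card_ord -mulr_suml (bigD1 i) //= eqxx big1.
    by rewrite -[_ *+ d]mulr_natr /=; ring.
  by move=> k /negPf ->.
move=> k _; rewrite !mxE eqxx /=.
have -> : (i == k) = (k == i) by rewrite eq_sym.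
by move: (M / rho ^+ 2) => A; case: (k == i) => /=; field.
Qed.

Lemma continuous_barrier M N rho p i x :
  {for x, continuous (barrier M N rho p i)}.
Proof.
have C j : {for x, continuous (fun z : 'rV[R]_d => z 0 j - p 0 j)}.
  by apply: continuousB; [exact: coord_continuous|exact: cst_continuous].
have C2 j : {for x, continuous (fun z : 'rV[R]_d => (z 0 j - p 0 j) ^+ 2)}.
  exact: (continuousM (C j) (C j)).
apply: continuousD; apply: continuousM; try exact: cst_continuous.
  apply: continuousD; last first.
    by apply: continuousM; [exact: cst_continuous | exact: C].
  apply: continuousB; last first.
    by apply: continuousM; [exact: cst_continuous|exact: C2].
  exact: continuous_at_sum.
apply: continuousM; first exact: C.
by apply: continuousB; [exact: cst_continuous | exact: C].
Qed.

Lemma closed_cube p rho : closed [set x | `|x - p| <= rho].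
Proof.
rewrite (_ : mkset _ = (fun x => `|x - p|) @^-1` [set t | t <= rho]) //.
apply: preimage_closed; last exact: closed_le.
move=> x _; apply: continuous_comp; last exact: norm_continuous.
by apply: continuousB; [exact: continuous_at_id|exact: cst_continuous].
Qed.

Lemma compact_cube p rho : compact [set x | `|x - p| <= rho].
Proof.
apply: bounded_closed_compact; last exact: closed_cube.
exists (rho + `|p|); split => [|y hy x xp]; first exact: num_real.
rewrite -(subrK p x); apply: le_trans (ler_normD _ _) _.
by apply: le_trans (ltW hy); rewrite lerD2r.
Qed.

Lemma compact_half_cube p rho i :
  compact [set x | `|x - p| <= rho /\ p 0 i <= x 0 i].
Proof.
apply: subclosed_compact (@compact_cube p rho) _; last by move=> x [].
apply: closedI; first exact: closed_cube.
apply: (@preimage_closed _ _ (fun x => x 0 i) [set t | p 0 i <= t]);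
  last exact: closed_ge.
by move=> x _; exact: coord_continuous.
Qed.

(* At a negative minimum the point is interior, where the second differences
   are nonnegative, against [symlap_barrier]. *)
Lemma barrier_majorizes w p i rho M F N :
  0 < rho -> F < N ->
  (forall x, `|x - p| <= rho -> {for x, continuous w}) ->
  (forall x, `|x - p| <= rho -> `|w x| <= M) ->
  (forall x, `|x - p| <= rho ->
    \forall t \near 0^'+, `|symlap w t x| <= F * t ^+ 2) ->
  forall x, `|x - p| <= rho -> p 0 i <= x 0 i ->
  (w x - w (mirror p i x)) / 2 <= barrier M N rho p i x.
Proof.
move=> rho0 FN wc wM wF x xp xi.
have M0 : 0 <= M by apply: le_trans (wM x xp).
set K := [set x | `|x - p| <= rho /\ p 0 i <= x 0 i].
(* The odd part of w under the reflection: it vanishes on the mirror plane, is bounded by M, and its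
   second differences are at most F t^2 in absolute value. *)
pose phi z : R := 2^-1 * (w z - w (mirror p i z)).
pose v z := barrier M N rho p i z - phi z.
have vc z : K z -> {for z, continuous v}.
  case=> zp zi; apply: continuousB; first exact: continuous_barrier.
  apply: continuousM; first exact: cst_continuous.
  apply: continuousB; first exact: wc.
  apply: continuous_comp; first exact: continuous_mirror.
  by apply: wc; apply: le_trans (mirror_dist _ _ _) zp.
have vK : {within K, continuous v}.
  by apply: continuous_in_subspaceT => z /set_mem; exact: vc.
have K0 : K !=set0 by exists x.
have [c cK cmin] := EVT_min_rV K0 (@compact_half_cube p rho i) vK.
suff vc0 : 0 <= v c.
  have := le_trans vc0 (cmin x (mem_set (conj xp xi))).
  by rewrite /v /phi subr_ge0 mulrC.
move: cK => /set_mem[cp ci]; rewrite leNgt; apply/negP => vneg.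
have cj j : `|c 0 j - p 0 j| <= rho.
  by apply: le_trans cp; move: (coord_le_norm (c - p) j); rewrite !mxE.
set S := \sum_(j < d) (c 0 j - p 0 j) ^+ 2.
set a := c 0 i - p 0 i.
have a0 : 0 <= a by rewrite subr_ge0.
have arho : a <= rho by exact: le_trans (ler_norm _) (cj i).
(* F t^2 dominates an absolute value for some t > 0, hence F >= 0. *)
have N0 : 0 < N.
  apply: le_lt_trans FN.
  have := wF c cp.
  have : \forall t \near (0:R)^'+, 0 < t by exact: nbhs_right_gt.
  move=> ht /(filterI ht) /filter_ex[t [t0 Ht]].
  have := le_trans (normr_ge0 _) Ht; rewrite pmulr_lge0 //.
  by rewrite exprn_gt0.
have phiM : phi c <= M.
  have := wM c cp; have := wM (mirror p i c) (le_trans (mirror_dist _ _ _) cp).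
  by rewrite /phi !ler_norml => /andP[? ?] /andP[? ?]; lra.
have barE : barrier M N rho p i c =
   M / rho ^+ 2 * (S - d%:R * a ^+ 2 + d%:R * rho * a) + N / 2 * (a * (rho - a)).
  by [].
have tail : 0 <= N / 2 * (a * (rho - a)).
  by rewrite !mulr_ge0 ?subr_ge0 // ltW.
have d1 : 1 <= d%:R :> R by rewrite ler1n (leq_ltn_trans (leq0n i) (ltn_ord i)).
have dpos : 0 <= (d%:R - 1) * a * (rho - a).
  by rewrite !mulr_ge0 ?subr_ge0.
(* a contact with a lateral face makes the barrier at least M *)
have big : rho ^+ 2 <= S - d%:R * a ^+ 2 + d%:R * rho * a -> False.
  move=> h; move: vneg; apply/negP; rewrite -leNgt /v subr_ge0.
  apply: le_trans phiM _; rewrite barE.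
  have : M <= M / rho ^+ 2 * (S - d%:R * a ^+ 2 + d%:R * rho * a).
    by rewrite -mulrA ler_peMr // mulrC ler_pdivlMr ?exprn_gt0 // mul1r.
  lra.
have Sa : a ^+ 2 <= S.
  rewrite /S (bigD1 i) //= lerDl; apply: sumr_ge0 => j _; exact: sqr_ge0.
(* On the mirror plane the odd part vanishes and the barrier is nonnegative, so a negative minimum
   lies off it. *)
have a_gt0 : 0 < a.
  rewrite lt_neqAle a0 andbT eq_sym; apply/eqP => a_eq0.
  have mc : mirror p i c = c.
    by rewrite /mirror -/a a_eq0 mulr0 scale0r subr0.
  move: vneg; apply/negP; rewrite -leNgt /v barE /phi mc a_eq0 !mulr0 mul0r.
  rewrite subrr !mulr0 expr0n /= ?mulr0 ?subr0 !addr0.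
  apply: mulr_ge0; first by rewrite divr_ge0 ?sqr_ge0.
  by rewrite /S; apply: sumr_ge0 => j _; exact: sqr_ge0.
have a_lt : a < rho.
  rewrite lt_neqAle arho andbT; apply/eqP => a_eq; apply: big.
  by move: Sa; rewrite a_eq; nra.
have cj_lt j : `|c 0 j - p 0 j| < rho.
  have [->|ji] := eqVneq j i; first by rewrite ger0_norm.
  rewrite lt_neqAle cj andbT; apply/eqP => eqj; apply: big.
  have : rho ^+ 2 + a ^+ 2 <= S.
    rewrite /S (bigD1 j) //= (bigD1 i) /= 1?eq_sym // -eqj real_normK ?num_real //.
    rewrite addrA lerDl; apply: sumr_ge0 => l _; exact: sqr_ge0.
  nra.
have inK : \forall t \near (0:R)^'+, forall k, K (c + t *: 'e_k) /\ K (c - t *: 'e_k).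
  have aux : \forall t \near (0:R)^'+, forall j, t < rho - `|c 0 j - p 0 j|.
    apply: filter_forall => j.
    by apply: nbhs_right_lt; rewrite subr_gt0.
  near=> t => k.
  have t0 : 0 < t by near: t; exact: nbhs_right_gt.
  have ta : t < a by near: t; exact: nbhs_right_lt.
  have tj : forall j, t < rho - `|c 0 j - p 0 j| by near: t.
  have gen s : `|s| <= t -> K (c + s *: 'e_k).
    move=> st; split.
      apply: norm_le_coord; first exact: ltW.
      move=> j; rewrite !mxE eqxx /= addrAC.
      apply: le_trans (ler_normD _ _) _; rewrite -lerBrDl.
      apply: le_trans (ltW (tj j)).
      apply: le_trans st; rewrite normrM ler_piMr //.
      by case: (j == k); rewrite ?normr1 ?normr0.
    rewrite !mxE eqxx /= -subr_ge0 addrAC -/a.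
    move: st; rewrite ler_norml => /andP[s1 s2].
    by case: (i == k) => /=; nra.
  split; [apply: gen | rewrite -scaleNr; apply: gen];
    by rewrite ?normrN gtr0_norm.
have Fc := wF c cp.
have Fm := wF (mirror p i c) (le_trans (mirror_dist _ _ _) cp).
have [t [t0 tK tF tF']] : exists t : R, [/\ 0 < t,
    forall k, K (c + t *: 'e_k) /\ K (c - t *: 'e_k),
    `|symlap w t c| <= F * t ^+ 2 &
    `|symlap w t (mirror p i c)| <= F * t ^+ 2].
  apply: (@filter_ex _ (0:R)^'+); near=> t; split; near: t => //.
  exact: nbhs_right_gt.
have : 0 <= symlap v t c.
  apply: sumr_ge0 => k _; have [k1 k2] := tK k.
  have := cmin _ (mem_set k1); have := cmin _ (mem_set k2); lra.
rewrite /v symlapB symlap_barrier /phi symlapZ symlapB.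
rewrite (symlap_mirror w p i t c).
move: tF tF'; rewrite !ler_norml => /andP[? ?] /andP[? ?].
(* The odd part contributes at most F t^2 and the barrier -N t^2, so the total is negative. *)
have : F * t ^+ 2 < N * t ^+ 2 by rewrite ltr_pM2r // exprn_gt0.
lra.
Unshelve. all: by end_near. Qed.

(** On the axis through p in direction i the barrier is at most linear in s, and the reflection
    exchanges p + s e_i and p - s e_i. The majorization is applied to w and to -w, with N = |F| + 1
    > F. *)
Lemma symmetric_difference_bound w p i rho M F s :
  0 < rho ->
  (forall x, `|x - p| <= rho -> {for x, continuous w}) ->
  (forall x, `|x - p| <= rho -> `|w x| <= M) ->
  (forall x, `|x - p| <= rho ->
    \forall t \near 0^'+, `|symlap w t x| <= F * t ^+ 2) ->
  0 <= s <= rho ->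
  `|w (p + s *: 'e_i) - w (p - s *: 'e_i)|
    <= (2 * M * d%:R / rho + (`|F| + 1) * rho) * s.
Proof.
move=> rho0 wc wM wF /andP[s0 srho].
set N := `|F| + 1.
have N0 : 0 <= N by rewrite addr_ge0.
have FN : F < N by rewrite (le_lt_trans (ler_norm _)) // ltrDl.
set x := p + s *: 'e_i.
have xcoord j : x 0 j - p 0 j = if j == i then s else 0.
  rewrite !mxE eqxx /=; case: eqP => _ /=; first by rewrite mulr1 addrC addKr.
  by rewrite mulr0 addr0 subrr.
have xp : `|x - p| <= rho.
  apply: norm_le_coord => [|j]; first exact: ltW.
  rewrite mxE [in X in _ + X]mxE xcoord; case: ifP => _.
    by rewrite ger0_norm.
  by rewrite normr0 ltW.
have xi : p 0 i <= x 0 i by rewrite -subr_ge0 xcoord eqxx.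
have mx : mirror p i x = p - s *: 'e_i.
  by rewrite /mirror xcoord eqxx /x mulrDl mul1r scalerDl opprD addrA addrK.
have M0 : 0 <= M by apply: le_trans (wM x xp).
have bx : barrier M N rho p i x <= (M * d%:R / rho + N * rho / 2) * s.
  rewrite /barrier !xcoord eqxx (bigD1 i) //= xcoord eqxx big1; last first.
    by move=> j /negPf ji; rewrite xcoord ji expr0n.
  have d1 : 1 <= d%:R :> R by rewrite ler1n (leq_ltn_trans (leq0n i) (ltn_ord i)).
  have -> : M * d%:R / rho = M / rho ^+ 2 * (d%:R * rho).
    by field; rewrite gt_eqF.
  have Mr : 0 <= M / rho ^+ 2 by rewrite divr_ge0 ?sqr_ge0.
  have h1 : s ^+ 2 + 0 - d%:R * s ^+ 2 + d%:R * rho * s <= d%:R * rho * s.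
    by have := sqr_ge0 s; nra.
  have := ler_wpM2l Mr h1.
  have : 0 <= N * s ^+ 2 by rewrite mulr_ge0 ?sqr_ge0.
  lra.
have up := @barrier_majorizes w p i rho M F N rho0 FN wc wM wF x xp xi.
rewrite mx in up.
have dn : (- w x - - w (p - s *: 'e_i)) / 2 <= barrier M N rho p i x.
  rewrite -mx; apply: (@barrier_majorizes (fun z => - w z) p i rho M F N) => // z zp.
    by apply: continuousN; exact: wc.
    by rewrite normrN; exact: wM.
  apply: filterS (wF z zp) => t.
  have -> : (fun z => - w z) = (fun z => (-1) * w z).
    by apply/funext => ?; rewrite mulN1r.
  by rewrite symlapZ mulN1r normrN.
have -> : 2 * M * d%:R / rho + N * rho = 2 * (M * d%:R / rho + N * rho / 2).
  by field; rewrite gt_eqF.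
move: bx up dn; rewrite ler_norml => ? ? ?; apply/andP; split; lra.
Qed.

Definition poisson_cst rho M F : R :=
  d%:R * (2 * M * d%:R / rho + (`|F| + 1) * rho).

(** The symmetric bound only compares points at equal distance from a centre, so each piece of the
    coordinate path is centred at its midpoint. Midpoints stay within rho of p, and the cubes of
    radius rho around them explain the radius 2 rho in the hypotheses. *)
Lemma poisson_lipschitz w p rho M F :
  0 < rho ->
  (forall x, `|x - p| <= 2 * rho -> {for x, continuous w}) ->
  (forall x, `|x - p| <= 2 * rho -> `|w x| <= M) ->
  (forall x, `|x - p| <= 2 * rho ->
    \forall t \near 0^'+, `|symlap w t x| <= F * t ^+ 2) ->
  forall y, `|y - p| <= rho -> `|w y - w p| <= poisson_cst rho M F * `|y - p|.
Proof.
move=> rho0 wc wM wF y yp.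
rewrite (mix_telescope w p y).
apply: le_trans (ler_norm_sum _ _ _) _.
rewrite /poisson_cst; set A := 2 * M * d%:R / rho + _.
have -> : d%:R * A * `|y - p| = \sum_(i < d) A * `|y - p|.
  by rewrite sumr_const card_ord -[RHS]mulr_natl mulrA.
apply: ler_sum => i _.
set c := y 0 i - p 0 i; set z := mix i p y.
have cy : `|c| <= `|y - p|.
  by have := coord_le_norm (y - p) i; rewrite !mxE.
set q := z + (2^-1 * c) *: 'e_i.
have qp : `|q - p| <= rho.
  apply: mix_segment_near => //; first by rewrite subrr normr0 ltW.
  by rewrite invr_ge0 invf_le1 ?ler1n //= ler0n.
have near2 x : `|x - q| <= rho -> `|x - p| <= 2 * rho.
  move=> xq; rewrite -(subrK q x) -addrA; apply: le_trans (ler_normD _ _) _; lra.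
have A0 : 0 <= A.
  have M0 : 0 <= M.
    by apply: le_trans (wM p _) => //; rewrite subrr normr0 mulr_ge0 // ltW.
  apply: addr_ge0; first by rewrite divr_ge0 ?(ltW rho0) // !mulr_ge0.
  by rewrite mulr_ge0 ?(ltW rho0) // addr_ge0.
have B := @symmetric_difference_bound w q i rho M F (`|c| / 2) rho0
  (fun x h => wc x (near2 x h)) (fun x h => wM x (near2 x h))
  (fun x h => wF x (near2 x h)).
have {}B : `|w (q + (`|c| / 2) *: 'e_i) - w (q - (`|c| / 2) *: 'e_i)| <=
     A * (`|c| / 2).
  by apply: B; rewrite divr_ge0 //=; have := le_trans cy yp; lra.
apply: (@le_trans _ _ (A * (`|c| / 2))); last first.
  by apply: ler_wpM2l => //; have := normr_ge0 c; lra.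
have [c0|c0] := leP 0 c.
  move: B; rewrite (ger0_norm c0); congr (`|w _ - w _| <= _).
    by rewrite /q -addrA -scalerDl; congr (_ + _ *: _); field.
  have e0 : 2^-1 * c - c / 2 = 0 by field.
  by rewrite /q -addrA -scalerBl e0 scale0r addr0.
move: B; rewrite (ltr0_norm c0) distrC; congr (`|w _ - w _| <= _).
  by rewrite /q -addrA -scalerBl; congr (_ + _ *: _); field.
have e0 : 2^-1 * c + - c / 2 = 0 by field.
by rewrite /q -addrA -scalerDl e0 scale0r addr0.
Qed.

End PoissonGradient.

(** * Directional derivatives *)

Section DirectionalCalculus.
Context {R : realType} {d : nat}.
Implicit Types (x y v : 'rV[R]_d) (f : 'rV[R]_d -> R).

Lemma is_derive_line f x v (s l : R) :
  is_derive (x + s *: v) v f l -> is_derive s 1 (fun u => f (x + u *: v)) l.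
Proof.
have E (h : R) : h^-1 *: (((fun u => f (x + u *: v)) \o shift s) (h *: 1) - f (x + s *: v)) =
    h^-1 *: ((f \o shift (x + s *: v)) (h *: v) - f (x + s *: v)).
  congr (_ *: (f _ - _)).
  by rewrite /= [h *: 1]mulr1 scalerDl addrCA.
case=> fD fl; split.
  by rewrite /derivable; under eq_fun do rewrite E.
by rewrite -fl /derive; under eq_fun do rewrite E.
Qed.

Lemma is_derive_comp1 (phi : R -> R) f x v (a b : R) :
  is_derive (f x) 1 phi a -> is_derive x v f b ->
  is_derive x v (fun z => phi (f z)) (a * b).
Proof.
move=> phia fb.
have fb0 : is_derive (0:R) 1 (fun u => f (x + u *: v)) b.
  by apply: is_derive_line; rewrite scale0r addr0.
have : is_derive (0:R) 1 (phi \o (fun u => f (x + u *: v))) (a * b).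
  by apply: is_derive1_comp; rewrite scale0r addr0.
have E (h : R) : h^-1 *: (((phi \o (fun u => f (x + u *: v))) \o shift 0) (h *: 1) -
     (phi \o (fun u => f (x + u *: v))) 0) =
    h^-1 *: (((fun z => phi (f z)) \o shift x) (h *: v) - phi (f x)).
  by rewrite /= [h *: 1]mulr1 addr0 scale0r addr0 [x + _]addrC.
case=> H1 H2; split.
  by move: H1; rewrite /derivable; under eq_fun do rewrite E.
by move: H2; rewrite /derive; under eq_fun do rewrite E.
Qed.

Lemma is_derive_expansion (g : R -> R) (s a e : R) :
  is_derive s 1 g a -> 0 < e ->
  \forall h \near (0:R), `|g (s + h) - g s - a * h| <= e * `|h|.
Proof.
move=> [gD ga] e0.
have : h^-1 *: ((g \o shift s) (h *: 1) - g s) @[h --> 0^'] --> a.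
  by rewrite -ga; exact: gD.
move=> /cvgrPdist_le /(_ e e0); rewrite near_withinE => H.
near=> h.
have [->|h0] := eqVneq h 0; first by rewrite addr0 subrr mulr0 subr0 normr0 mulr0.
have := near H h; move=> /(_ _ h0); rewrite /= [h *: 1]mulr1 => H1.
have -> : g (s + h) - g s - a * h = - (h * (a - h^-1 * (g (h + s) - g s))).
  by rewrite [h + s]addrC; field.
by rewrite normrN normrM mulrC ler_wpM2r //; apply: H1.
Unshelve. all: by end_near. Qed.

(** The mean value theorem is applied once, to g(s) + g(-s) - a s^2, whose derivative g1(s) - g1(-s)
    - 2 a s is o(s) as soon as g1 is differentiable at 0; continuity of the second derivative does
    not enter. *)
Lemma second_difference (g g1 : R -> R) (a e : R) :
  (\forall t \near (0:R), is_derive (t : R) 1 g (g1 t)) -> is_derive (0:R) 1 g1 a -> 0 < e ->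
  \forall t \near 0^'+, `|g t + g (- t) - 2 * g 0 - a * t ^+ 2| <= e * t ^+ 2.
Proof.
move=> gD g1D e0.
have e2 : 0 < e / 2 by rewrite divr_gt0.
have H : \forall t \near (0:R), is_derive (t : R) 1 g (g1 t) /\
    `|g1 t - g1 0 - a * t| <= e / 2 * `|t|.
  apply: filterI gD _.
  by have := is_derive_expansion g1D e2; apply: filterS => t; rewrite add0r.
move: H => /nbhs_ballP[del /= del0 H].
have Hd (t : R) : `|t| < del -> is_derive t 1 g (g1 t) /\
    `|g1 t - g1 0 - a * t| <= e / 2 * `|t|.
  by move=> td; apply: H; rewrite -ball_normE /= sub0r normrN.
near=> t.
have t0 : 0 < t by near: t; exact: nbhs_right_gt.
have td : t < del by near: t; exact: nbhs_right_lt.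
pose G := (fun s => g s + g (- s) - a * s ^+ 2) : R -> R.
pose dG := (fun s => g1 s + g1 (- s) * (- 1) - a * (2 * s)) : R -> R.
have GD (s : R) : `|s| < del -> is_derive s 1 G (dG s).
  move=> sd; have D1 := (Hd s sd).1.
  have D2 : is_derive s 1 (fun s => g (- s)) (g1 (- s) * (- 1)).
    apply: (@is_derive1_comp _ g (fun s => - s)); last exact: is_deriveNid.
    by apply: (Hd (- s) _).1; rewrite normrN.
  have D3 : is_derive s 1 (fun s : R => a * s ^+ 2) (a * (2 * s)).
    apply: is_derive_eq; rewrite /GRing.scale /=; ring.
  exact: (is_deriveB (is_deriveD D1 D2) D3).
have lt_del (s : R) : s \in `[0, t] -> `|s| < del.
  by rewrite in_itv /= => /andP[s0 st]; rewrite ger0_norm // (le_lt_trans st).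
have Gc : {within `[0, t], continuous G}.
  apply: derivable_within_continuous => s st.
  by have [] := GD s (lt_del s st).
have [c ct ] := MVT_segment (ltW t0)
  (fun s st => GD s (lt_del s (subset_itv_oo_cc st))) Gc.
rewrite /G oppr0 expr0n /= mulr0 subr0 addr0 => GE.
have -> : g t + g (- t) - 2 * g 0 - a * t ^+ 2 = dG c * t.
  by rewrite -GE; ring.
have cdel := lt_del c ct.
have [_ B1] := Hd c cdel.
have [_ B2] : is_derive (- c) 1 g (g1 (- c)) /\
    `|g1 (- c) - g1 0 - a * (- c)| <= e / 2 * `|- c|.
  by apply: Hd; rewrite normrN.
move: ct; rewrite in_itv /= => /andP[c0 ct].
rewrite normrN (ger0_norm c0) in B2; rewrite (ger0_norm c0) in B1.
rewrite normrM (gtr0_norm t0) expr2 mulrA ler_pM2r //.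
have -> : dG c = (g1 c - g1 0 - a * c) - (g1 (- c) - g1 0 - a * (- c)).
  by rewrite /dG; ring.
apply: le_trans (ler_normB _ _) _.
have : e * c <= e * t by rewrite ler_pM2l.
lra.
Unshelve. all: by end_near. Qed.

Lemma second_difference_dir f f1 x v (a e : R) :
  (\forall z \near x, is_derive (z : 'rV[R]_d) v f (f1 z)) -> is_derive x v f1 a -> 0 < e ->
  \forall t \near (0:R)^'+,
    `|f (x + t *: v) + f (x - t *: v) - 2 * f x - a * t ^+ 2| <= e * t ^+ 2.
Proof.
move=> fD f1D e0.
have c : {for (0:R), continuous (fun u : R => x + u *: v)}.
  apply: continuousD; first exact: cvg_cst.
  by apply: continuousZr_tmp; exact: continuous_at_id.
have gD : \forall u \near (0:R), is_derive (u:R) 1 (fun u => f (x + u *: v)) (f1 (x + u *: v)).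
  have : nbhs (x + (0:R) *: v) [set z | is_derive z v f (f1 z)].
    by rewrite scale0r addr0.
  move=> /c H.
  have {H} : \forall u \near (0:R), is_derive (x + u *: v) v f (f1 (x + u *: v)) by [].
  by apply: filterS => u; exact: is_derive_line.
have g1D : is_derive (0:R) 1 (fun u => f1 (x + u *: v)) a.
  by apply: is_derive_line; rewrite scale0r addr0.
have := second_difference gD g1D e0.
by apply: filterS => t; rewrite scale0r addr0 scaleNr.
Qed.

Lemma mvt_coordinate f (D : 'rV[R]_d -> R) x i (a : R) :
  (forall c, 0 <= c <= 1 -> is_derive (x + (c * a) *: 'e_i) 'e_i f
     (D (x + (c * a) *: 'e_i))) ->
  exists2 c, 0 <= c <= 1 & f (x + a *: 'e_i) - f x = D (x + (c * a) *: 'e_i) * a.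
Proof.
move=> fD; pose g := (fun c => f (x + (c * a) *: 'e_i)) : R -> R.
have gD (c : R) : 0 <= c <= 1 -> is_derive c 1 g (D (x + (c * a) *: 'e_i) * a).
  move=> c01.
  apply: (@is_derive1_comp _ (fun u => f (x + u *: 'e_i)) (fun c => c * a)).
    by apply: is_derive_line; exact: fD.
  by apply: is_derive_eq; rewrite /GRing.scale /=; ring.
have [||c c01] := @MVT_segment _ g (fun c => D (x + (c * a) *: 'e_i) * a) 0 1 ler01.
- by move=> c; rewrite in_itv /= => /andP[? ?]; apply: gD; rewrite !ltW.
- by apply: derivable_within_continuous => c; rewrite in_itv /= => /gD[].
rewrite /g mul1r mul0r scale0r addr0 subr0 mulr1 => E.
by exists c => //; move: c01; rewrite in_itv.
Qed.

(** The increment is split along the coordinate path, with the mean value theorem on each piece and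
    continuity of the partials at y. This is what differentiates a dilation tau |-> q(tau x). *)
Lemma is_derive_of_partials f (D : 'I_d -> 'rV[R]_d -> R) y v :
  (forall i, \forall z \near y, is_derive (z : 'rV[R]_d) 'e_i f (D i z)) ->
  (forall i, {for y, continuous (D i)}) ->
  is_derive y v f (\sum_(i < d) v 0 i * D i y).
Proof.
move=> fD Dc.
suff H : h^-1 *: ((f \o shift y) (h *: v) - f y) @[h --> 0^']
    --> \sum_(i < d) v 0 i * D i y.
  split; first by apply/cvg_ex; exists (\sum_(i < d) v 0 i * D i y).
  exact/cvg_lim.
set L := \sum_(i < d) v 0 i * D i y.
apply/cvgrPdist_le => e e0; rewrite near_withinE.
(* The extra 1 keeps V positive when v = 0. *)
set V := \sum_(i < d) `|v 0 i| + 1.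
have V0 : 0 < V by rewrite ltr_wpDl // sumr_ge0.
have : \forall z \near y, forall i,
    is_derive z 'e_i f (D i z) /\ `|D i y - D i z| <= e / V.
  apply: (@filter_forall _ _ _ _ (nbhs_filter y)) => i.
  apply: (@filterI _ _ (nbhs_filter y)); first exact: fD.
  by have /cvgrPdist_le := Dc i; apply; rewrite divr_gt0.
move=> /nbhs_ballP[del /= del0 H].
have {}H z : `|z - y| < del -> forall i,
    is_derive z 'e_i f (D i z) /\ `|D i y - D i z| <= e / V.
  by move=> zd; apply: H; rewrite -ball_normE /= distrC.
near=> h => h0.
have hv : `|h *: v| < del.
  rewrite normrZ; apply: (@le_lt_trans _ _ (`|h| * (`|v| + 1))).
    by rewrite ler_wpM2l // lerDl.
  rewrite -ltr_pdivlMr ?ltr_wpDl //.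
  near: h; apply/nbhs_ballP; exists (del / (`|v| + 1)) => /=.
    by rewrite divr_gt0 // ltr_wpDl.
  by move=> h; rewrite -ball_normE /= sub0r normrN.
have ye : `|y - y| <= `|h *: v| by rewrite subrr normr0.
have hve : `|y + h *: v - y| <= `|h *: v| by rewrite addrC addKr.
rewrite /= [h *: v + y]addrC (mix_telescope f y (y + h *: v)) /L.
rewrite [_ *: _]mulr_sumr -sumrB.
apply: le_trans (ler_norm_sum _ _ _) _.
apply: (@le_trans _ _ (\sum_(i < d) `|v 0 i| * (e / V))); last first.
  rewrite -mulr_suml mulrA ler_pdivrMr // mulrC ler_pM2l //.
  by rewrite /V lerDl.
apply: ler_sum => i _.
have -> : (y + h *: v) 0 i - y 0 i = h * v 0 i by rewrite !mxE addrC addKr.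
set z := mix i y (y + h *: v).
have zn c : 0 <= c <= 1 -> `|z + (c * (h * v 0 i)) *: 'e_i - y| < del.
  move=> c01; apply: le_lt_trans hv.
  have -> : h * v 0 i = (y + h *: v) 0 i - y 0 i by rewrite !mxE addrC addKr.
  exact: mix_segment_near.
have [c c01 ->] := mvt_coordinate (fun c c01 => (H _ (zn c c01) i).1).
have [_] := H _ (zn c c01) i.
move: (D i (z + _)) => Dz HD.
have -> : v 0 i * D i y - h^-1 * (Dz * (h * v 0 i)) = v 0 i * (D i y - Dz).
  by field.
by rewrite normrM ler_wpM2l.
Unshelve. all: by end_near. Qed.

End DirectionalCalculus.

(** * The Euclidean norm *)

Section EuclideanNorm.
Context {R : realType} {d : nat}.
Implicit Types (x y v : 'rV[R]_d).

Lemma dotxx_ge0 x : 0 <= dot x x.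
Proof. by apply: sumr_ge0 => i _; rewrite -expr2 sqr_ge0. Qed.

Lemma enorm_ge0 x : 0 <= enorm x.
Proof. exact: sqrtr_ge0. Qed.

Lemma enorm_sqr x : enorm x ^+ 2 = dot x x.
Proof. by rewrite sqr_sqrtr // dotxx_ge0. Qed.

Lemma dotC x y : dot x y = dot y x.
Proof. by apply: eq_bigr => i _; rewrite mulrC. Qed.

Lemma dotDl x y v : dot (x + y) v = dot x v + dot y v.
Proof. by rewrite -big_split; apply: eq_bigr => i _; rewrite mxE mulrDl. Qed.

Lemma dotZl c x v : dot (c *: x) v = c * dot x v.
Proof. by rewrite /dot mulr_sumr; apply: eq_bigr => i _; rewrite mxE mulrA. Qed.

Lemma dotDr x y v : dot v (x + y) = dot v x + dot v y.
Proof. by rewrite !(dotC v) dotDl. Qed.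

Lemma dotZr c x v : dot v (c *: x) = c * dot v x.
Proof. by rewrite !(dotC v) dotZl. Qed.

Lemma enormZ c x : enorm (c *: x) = `|c| * enorm x.
Proof.
rewrite /enorm dotZl dotZr mulrA -expr2 sqrtrM ?sqr_ge0 //.
by rewrite sqrtr_sqr.
Qed.

Lemma enormN x : enorm (- x) = enorm x.
Proof. by rewrite -scaleN1r enormZ normrN1 mul1r. Qed.

Lemma cauchy_schwarz x y : dot x y <= enorm x * enorm y.
Proof.
have [xy0|] := leP (dot x y) 0.
  by apply: le_trans xy0 _; rewrite mulr_ge0 ?enorm_ge0.
move=> xy0; rewrite -ler_sqr ?nnegrE ?mulr_ge0 ?enorm_ge0 ?(ltW xy0) //.
rewrite exprMn !enorm_sqr.
have H := dotxx_ge0 (dot y y *: x + (- dot x y) *: y).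
rewrite !(dotDl, dotDr, dotZl, dotZr) (dotC y x) in H.
have [y0|y0] := eqVneq (dot y y) 0.
  (* With (y, y) = 0 and (x, y) > 0, this multiple of y would give the square norm the value -1. *)
  have := dotxx_ge0 (x + (- ((dot x x + 1) / (2 * dot x y))) *: y).
  rewrite !(dotDl, dotDr, dotZl, dotZr) (dotC y x) y0 !mulr0 addr0.
  set u := _ / _; have : u * dot x y = (dot x x + 1) / 2.
    by rewrite /u; field; rewrite gt_eqF.
  lra.
have yy : 0 < dot y y by rewrite lt_neqAle eq_sym y0 dotxx_ge0.
have : 0 <= dot y y * (dot x x * dot y y - dot x y ^+ 2).
  by move: H; congr (0 <= _); ring.
by rewrite pmulr_rge0 // subr_ge0.
Qed.

Lemma enorm_triangle x y : enorm (x + y) <= enorm x + enorm y.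
Proof.
rewrite -ler_sqr ?nnegrE ?addr_ge0 ?enorm_ge0 // enorm_sqr.
rewrite dotDl !dotDr (dotC y x) -!enorm_sqr.
have := cauchy_schwarz x y; nra.
Qed.

Lemma coord_le_enorm x i : `|x 0 i| <= enorm x.
Proof.
rewrite -ler_sqr ?nnegrE ?enorm_ge0 // enorm_sqr real_normK ?num_real //.
rewrite /dot (bigD1 i) //= -expr2 lerDl sumr_ge0 // => j _.
by rewrite -expr2 sqr_ge0.
Qed.

Lemma norm_le_enorm x : `|x| <= enorm x.
Proof. by apply: norm_le_coord; [exact: enorm_ge0 | exact: coord_le_enorm]. Qed.

Lemma enorm_le_norm x : enorm x <= d%:R * `|x|.
Proof.
have [d0|d0] := posnP d.
  rewrite /enorm /dot; subst d; rewrite big_ord0 sqrtr0 mulr_ge0 //.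
rewrite -ler_sqr ?nnegrE ?mulr_ge0 ?enorm_ge0 // enorm_sqr exprMn.
apply: (@le_trans _ _ (\sum_(i < d) `|x| ^+ 2)).
  apply: ler_sum => i _; rewrite -expr2 -real_normK ?num_real //.
  by rewrite ler_sqr ?nnegrE // coord_le_norm.
rewrite sumr_const card_ord -[_ *+ d]mulr_natl ler_wpM2r ?sqr_ge0 //.
by rewrite expr2 ler_peMl // ler1n.
Qed.

Lemma continuous_enorm x : {for x, continuous enorm}.
Proof.
have C : {for x, continuous (fun z : 'rV[R]_d => dot z z)}.
  apply: continuous_at_sum => i.
  by apply: continuousM; exact: coord_continuous.
apply: (@continuous_comp _ _ _ (fun z : 'rV[R]_d => dot z z) Num.sqrt) => //.
exact: sqrt_continuous.
Qed.

Lemma is_derive_coord x v i : is_derive x v (fun z : 'rV[R]_d => z 0 i) (v 0 i).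
Proof.
suff H : h^-1 *: (((fun z : 'rV[R]_d => z 0 i) \o shift x) (h *: v) - x 0 i)
    @[h --> 0^'] --> v 0 i.
  split; first by apply/cvg_ex; exists (v 0 i).
  exact/cvg_lim.
apply: cvg_near_cst; rewrite near_withinE; near=> h => h0.
by rewrite /= !mxE /GRing.scale /=; field.
Unshelve. all: by end_near. Qed.

Lemma is_derive_enorm x i : 0 < enorm x ->
  is_derive x 'e_i enorm (x 0 i / enorm x).
Proof.
move=> x0.
have D : is_derive x 'e_i (fun z : 'rV[R]_d => dot z z) (2 * x 0 i).
  have Dj (j : 'I_d) : is_derive x 'e_i (fun z : 'rV[R]_d => z 0 j * z 0 j)
      (2 * x 0 j * (j == i)%:R).
    have := is_deriveM (is_derive_coord x 'e_i j) (is_derive_coord x 'e_i j).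
    move=> H; apply: (is_derive_eq H); rewrite mxE eqxx /GRing.scale /=; ring.
  have := is_derive_sum Dj.
  have -> : \sum_(j < d) (fun z : 'rV[R]_d => z 0 j * z 0 j) = (fun z : 'rV[R]_d => dot z z).
    by apply/funext => z; rewrite fct_sumE.
  move=> H; apply: (is_derive_eq H).
  by rewrite (bigD1 i) //= eqxx mulr1 big1 ?addr0 // => j /negPf ->; rewrite mulr0.
have s0 : 0 < dot x x by rewrite -enorm_sqr exprn_gt0.
have H : is_derive x 'e_i enorm ((2 * enorm x)^-1 * (2 * x 0 i)).
  exact: (@is_derive_comp1 _ _ Num.sqrt (fun z : 'rV[R]_d => dot z z) x 'e_i _ _
    (is_derive1_sqrt s0) D).
apply: (is_derive_eq H); by rewrite -/(enorm x); field; rewrite gt_eqF.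
Qed.

Lemma is_derive_unit_coord x i : 0 < enorm x ->
  is_derive x 'e_i (fun z : 'rV[R]_d => z 0 i / enorm z)
   ((enorm x)^-1 - x 0 i ^+ 2 / enorm x ^+ 3).
Proof.
move=> x0; have x1 : enorm x != 0 by rewrite gt_eqF.
have Dinv : is_derive (enorm x) 1 (fun u : R => u^-1) (- enorm x ^- 2).
  have := @is_deriveV _ (@id R) (enorm x) 1 1 x1 (is_derive_id _ _).
  by rewrite /GRing.scale /= mulr1.
have H := is_deriveM (is_derive_coord x 'e_i i)
  (is_derive_comp1 Dinv (is_derive_enorm i x0)).
by apply: (is_derive_eq H); rewrite mxE !eqxx /GRing.scale /=; field.
Qed.

Lemma open_enorm_gt (r : R) : open [set x : 'rV[R]_d | r < enorm x].
Proof.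
apply: (@open_comp _ _ enorm [set t | r < t]); last exact: open_gt.
by move=> x _; exact: continuous_enorm.
Qed.

End EuclideanNorm.

(** * The conjugated Helmholtz equation *)

Section Twist.
Context {R : realType} {d : nat}.
Implicit Types (x y v : 'rV[R]_d) (a b : 'rV[R]_d -> R)
  (da db dda ddb : 'I_d -> 'rV[R]_d -> R) (V : set 'rV[R]_d) (kappa : R).

Definition C1_on V a da : Prop := forall y, V y ->
  [/\ {for y, continuous a}, forall i, is_derive y 'e_i a (da i y)
    & forall i, {for y, continuous (da i)}].

(* [da] and [dda] are the first and the unmixed second partial derivatives. *)
Definition helmholtz_on kappa V a da dda : Prop :=
  C1_on V a da /\ forall y, V y ->
  (forall i, is_derive y 'e_i (da i) (dda i y)) /\
  \sum_(i < d) dda i y = - kappa ^+ 2 * a y.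

Lemma helmholtz_onN kappa V a da dda : helmholtz_on kappa V a da dda ->
  helmholtz_on kappa V (fun y => - a y) (fun i y => - da i y) (fun i y => - dda i y).
Proof.
case=> Ha Hd; split=> y Vy.
  have [ac ad dc] := Ha y Vy; split.
  - exact: continuousN.
  - by move=> i; exact: is_deriveN.
  - by move=> i; exact: continuousN.
have [dd s] := Hd y Vy; split; first by move=> i; exact: is_deriveN.
by rewrite sumrN s mulrN.
Qed.

(* The real part of exp(-i kappa |y|) (a + i b); the imaginary part is the twist
   of (b, -a). *)
Definition twist kappa a b y : R :=
  cos (kappa * enorm y) * a y + sin (kappa * enorm y) * b y.

(** Product rule: differentiating the phase is a quarter turn, which turns the twist of (a, b) into
    that of (b, -a). *)
Definition twistD kappa a b da db (i : 'I_d) y : R :=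
  twist kappa (da i) (db i) y
  + kappa * (y 0 i / enorm y) * twist kappa b (fun z => - a z) y.

Lemma is_derive_cos_enorm kappa y i : 0 < enorm y ->
  is_derive y 'e_i (fun z : 'rV[R]_d => cos (kappa * enorm z))
    (- sin (kappa * enorm y) * (kappa * (y 0 i / enorm y))).
Proof.
move=> y0; apply: is_derive_comp1.
exact: (is_deriveZ kappa (is_derive_enorm i y0)).
Qed.

Lemma is_derive_sin_enorm kappa y i : 0 < enorm y ->
  is_derive y 'e_i (fun z : 'rV[R]_d => sin (kappa * enorm z))
    (cos (kappa * enorm y) * (kappa * (y 0 i / enorm y))).
Proof.
move=> y0; apply: is_derive_comp1.
exact: (is_deriveZ kappa (is_derive_enorm i y0)).
Qed.

Lemma is_derive_twist kappa a b y i (la lb : R) : 0 < enorm y ->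
  is_derive y 'e_i a la -> is_derive y 'e_i b lb ->
  is_derive y 'e_i (twist kappa a b)
    (cos (kappa * enorm y) * la + sin (kappa * enorm y) * lb
     + kappa * (y 0 i / enorm y) * twist kappa b (fun z => - a z) y).
Proof.
move=> y0 al bl.
have H := is_deriveD (is_deriveM (is_derive_cos_enorm kappa i y0) al)
  (is_deriveM (is_derive_sin_enorm kappa i y0) bl).
by apply: (is_derive_eq H); rewrite /twist /GRing.scale /=; ring.
Qed.

Lemma continuous_twist kappa a b y :
  {for y, continuous a} -> {for y, continuous b} ->
  {for y, continuous (twist kappa a b)}.
Proof.
move=> ac bc.
have C : {for y, continuous (fun z : 'rV[R]_d => kappa * enorm z)}.
  by apply: continuousM; [exact: cst_continuous|exact: continuous_enorm].
apply: continuousD; apply: continuousM => //.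
  exact: (continuous_comp C (@continuous_cos _ _)).
exact: (continuous_comp C (@continuous_sin _ _)).
Qed.

Lemma C1_twist kappa V a b da db : (forall y, V y -> 0 < enorm y) ->
  C1_on V a da -> C1_on V b db ->
  C1_on V (twist kappa a b) (twistD kappa a b da db).
Proof.
move=> V0 Ha Hb y Vy; have [ac ad dac] := Ha y Vy; have [bc bd dbc] := Hb y Vy.
have y0 := V0 y Vy.
split=> [|i|i]; first exact: continuous_twist.
  exact: (is_derive_twist kappa y0 (ad i) (bd i)).
apply: continuousD; first exact: continuous_twist.
apply: continuousM; last by apply: continuous_twist => //; exact: continuousN.
apply: continuousM; first exact: cst_continuous.
apply: continuousM; first exact: coord_continuous.
by apply: continuousV; [rewrite gt_eqF | exact: continuous_enorm].
Qed.

Lemma sum_unit_coord_sqr y : 0 < enorm y ->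
  \sum_(i < d) (y 0 i / enorm y) ^+ 2 = 1.
Proof.
move=> y0; under eq_bigr do rewrite expr_div_n expr2.
by rewrite -mulr_suml -/(dot y y) -enorm_sqr divff // expf_neq0 // gt_eqF.
Qed.

Definition twistDD kappa a b da db dda ddb (i : 'I_d) y : R :=
  let r := y 0 i / enorm y in
  twist kappa (dda i) (ddb i) y
  + kappa * r * twist kappa (db i) (fun z => - da i z) y
  + kappa * ((enorm y)^-1 - y 0 i ^+ 2 / enorm y ^+ 3)
      * twist kappa b (fun z => - a z) y
  + kappa * r * twistD kappa b (fun z => - a z) db (fun i z => - da i z) i y.

Lemma is_derive_twistD kappa V a b da db dda ddb y i : 0 < enorm y -> V y ->
  helmholtz_on kappa V a da dda -> helmholtz_on kappa V b db ddb ->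
  is_derive y 'e_i (twistD kappa a b da db i) (twistDD kappa a b da db dda ddb i y).
Proof.
move=> y0 Vy [Ha Ha2] [Hb Hb2].
have [_ ad _] := Ha y Vy; have [_ bd _] := Hb y Vy.
have [ad2 _] := Ha2 y Vy; have [bd2 _] := Hb2 y Vy.
have D1 := is_derive_twist kappa y0 (ad2 i) (bd2 i).
have D2 := is_derive_twist kappa y0 (bd i)
  (is_deriveN (ad i) : is_derive y 'e_i (fun z => - a z) (- da i y)).
have D3 := is_deriveM (is_deriveZ kappa (is_derive_unit_coord i y0)) D2.
apply: (is_derive_eq (is_deriveD D1 D3)).
have scaleE (u w : R) : u *: w = u * w by [].
by rewrite /twistDD /twistD /twist /= !scaleE; ring.
Qed.

(* Real part of  Laplacian u = - (2 i kappa / |y|) (mu + y.grad) u  with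
   u = exp(-i kappa |y|) (a + i b) and mu = (d - 1) / 2. *)
Lemma laplacian_twist kappa V a b da db dda ddb y : 0 < enorm y -> V y ->
  helmholtz_on kappa V a da dda -> helmholtz_on kappa V b db ddb ->
  \sum_(i < d) twistDD kappa a b da db dda ddb i y =
  2 * kappa / enorm y * ((d%:R - 1) / 2 * twist kappa b (fun z => - a z) y
    + \sum_(i < d) y 0 i * twistD kappa b (fun z => - a z) db (fun i z => - da i z) i y).
Proof.
move=> y0 Vy [_ Ha2] [_ Hb2].
have [_ sa] := Ha2 y Vy; have [_ sb] := Hb2 y Vy.
have s1 := sum_unit_coord_sqr y0.
have yn : enorm y != 0 by rewrite gt_eqF.
set P := twist kappa a b y; set Q := twist kappa b (fun z => - a z) y.
pose r i := y 0 i / enorm y.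
pose DQ i := twistD kappa b (fun z => - a z) db (fun i z => - da i z) i y.
(* Twists of first derivatives are rewritten through [DQ]. Since the squares of r sum to 1, the
   terms kappa^2 P then cancel against the Helmholtz equation, and the Q terms add up to (d - 1)
   kappa Q / |y|. *)
rewrite (eq_bigr (fun i => twist kappa (dda i) (ddb i) y +
  (2 * kappa * (r i * DQ i) + (kappa ^+ 2 * P * r i ^+ 2 +
   (kappa * Q / enorm y - kappa * Q / enorm y * r i ^+ 2))))); last first.
  move=> i _; rewrite /twistDD -/(DQ i) -/Q -/(r i).
  have -> : twist kappa (db i) (fun z => - da i z) y = DQ i + kappa * r i * P.
    rewrite /DQ /twistD -/(r i) /P /twist; ring.
  have -> : y 0 i ^+ 2 / enorm y ^+ 3 = r i ^+ 2 / enorm y by rewrite /r; field.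
  by ring.
rewrite big_split /=.
have -> : \sum_(i < d) twist kappa (dda i) (ddb i) y = - kappa ^+ 2 * P.
  by rewrite /twist big_split /= -!mulr_sumr sa sb /P /twist; ring.
rewrite !big_split /= sumrN -!mulr_sumr s1 sumr_const card_ord.
have -> : \sum_(i < d) y 0 i * DQ i = enorm y * \sum_(i < d) r i * DQ i.
  by rewrite mulr_sumr; apply: eq_bigr => i _; rewrite /r; field.
by rewrite -[_ *+ d]mulr_natl; field.
Qed.

End Twist.

(** * Riemann sums and symmetric Laplacians *)

Section SymmetricLaplacian.
Context {R : realType} {d : nat}.
Implicit Types (x y p : 'rV[R]_d) (w : 'rV[R]_d -> R) (A c tau : R).

(** The Laplacian at x in the sense of symmetric differences; it passes to finite sums and to
    dilations without any second derivative of the result. *)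
Definition has_symlap w x A : Prop := forall e : R, 0 < e ->
  \forall t \near (0:R)^'+, `|symlap w t x - A * t ^+ 2| <= e * t ^+ 2.

Lemma has_symlapZ c w x A : has_symlap w x A ->
  has_symlap (fun z => c * w z) x (c * A).
Proof.
move=> wA e e0; have c0 : 0 < `|c| + 1 by rewrite ltr_wpDl.
apply: filterS (wA (e / (`|c| + 1)) (divr_gt0 e0 c0)) => t H.
rewrite symlapZ -mulrA -mulrBr normrM.
apply: le_trans (ler_wpM2l (normr_ge0 c) H) _.
rewrite mulrA ler_wpM2r ?sqr_ge0 // mulrCA ler_piMr ?(ltW e0) //.
by rewrite ler_pdivrMr // mul1r lerDl.
Qed.

Lemma has_symlapD w1 w2 x A1 A2 : has_symlap w1 x A1 -> has_symlap w2 x A2 ->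
  has_symlap (fun z => w1 z + w2 z) x (A1 + A2).
Proof.
move=> H1 H2 e e0; have e2 : 0 < e / 2 by rewrite divr_gt0.
apply: filterS2 (H1 _ e2) (H2 _ e2) => t B1 B2.
have -> : symlap (fun z => w1 z + w2 z) t x = symlap w1 t x + symlap w2 t x.
  by rewrite /symlap -big_split /=; apply: eq_bigr => k _; ring.
rewrite mulrDl opprD addrACA; apply: le_trans (ler_normD _ _) _; lra.
Qed.

Lemma has_symlap_sum n (w : 'I_n -> 'rV[R]_d -> R) x (A : 'I_n -> R) :
  (forall j, has_symlap (w j) x (A j)) ->
  has_symlap (fun z => \sum_(j < n) w j z) x (\sum_(j < n) A j).
Proof.
elim: n w A => [|n IH] w A H.
  rewrite big_ord0 => e e0; near=> t.
  rewrite /symlap big1 ?subr0 ?mul0r ?subrr ?normr0 ?mulr_ge0 ?sqr_ge0 ?ltW //.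
  move=> k _. rewrite !big_ord0. by rewrite mulr0 subr0 addr0.
rewrite big_ord_recr /=.
have -> : (fun z => \sum_(j < n.+1) w j z) =
    (fun z => \sum_(j < n) w (widen_ord (leqnSn n) j) z + w ord_max z).
  by apply/funext => z; rewrite big_ord_recr.
by apply: has_symlapD (H _); apply: (IH (fun j => w (widen_ord (leqnSn n) j))).
Unshelve. all: by end_near. Qed.

Lemma at_right0_scale (P : R -> Prop) c : 0 < c ->
  (\forall t \near (0:R)^'+, P t) -> \forall t \near (0:R)^'+, P (c * t).
Proof.
move=> c0 /= [e /= e0 H]; exists (e / c); rewrite /= ?divr_gt0 // => t /=.
rewrite /ball_ /= sub0r normrN ltr_pdivlMr // => te t0.
apply: H; last by rewrite mulr_gt0.
by rewrite /ball_ /= sub0r normrN normrM (gtr0_norm c0) mulrC.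
Qed.

Lemma has_symlap_dilate w x tau A : 0 < tau -> has_symlap w (tau *: x) A ->
  has_symlap (fun z => w (tau *: z)) x (tau ^+ 2 * A).
Proof.
move=> tau0 H e e0.
have e1 : 0 < e / tau ^+ 2 by rewrite divr_gt0 // exprn_gt0.
apply: filterS (at_right0_scale tau0 (H _ e1)) => t.
have -> : symlap w (tau * t) (tau *: x) = symlap (fun z => w (tau *: z)) t x.
  by apply: eq_bigr => k _; rewrite scalerDr scalerBr !scalerA.
have -> : A * (tau * t) ^+ 2 = tau ^+ 2 * A * t ^+ 2 by ring.
by congr (_ <= _); field; rewrite gt_eqF.
Qed.

Lemma has_symlap_partials w (D : 'I_d -> 'rV[R]_d -> R) x (A : 'I_d -> R) :
  (forall i, \forall z \near x, is_derive (z : 'rV[R]_d) 'e_i w (D i z)) ->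
  (forall i, is_derive x 'e_i (D i) (A i)) ->
  has_symlap w x (\sum_(i < d) A i).
Proof.
move=> wD DA e e0.
have d0 : 0 < d%:R + 1 :> R by rewrite ltr_wpDl.
have e1 : 0 < e / (d%:R + 1) by rewrite divr_gt0.
have : \forall t \near (0:R)^'+, forall i, `|w (x + t *: 'e_i) + w (x - t *: 'e_i)
    - 2 * w x - A i * t ^+ 2| <= e / (d%:R + 1) * t ^+ 2.
  by apply: filter_forall => i; exact: second_difference_dir (wD i) (DA i) e1.
apply: filterS => t H.
rewrite /symlap mulr_suml -sumrB; apply: le_trans (ler_norm_sum _ _ _) _.
apply: le_trans (ler_sum _ (fun i _ => H i)) _.
rewrite sumr_const card_ord -[_ *+ d]mulr_natl mulrA ler_wpM2r ?sqr_ge0 //.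
by rewrite mulrCA ler_piMr ?(ltW e0) // ler_pdivrMr // mul1r lerDl.
Qed.

End SymmetricLaplacian.

Section RiemannSums.
Context {R : realType} {d : nat}.
Implicit Types (x : 'rV[R]_d) (H D : R -> R).

Definition node (T : R) (N : nat) (j : nat) : R := T + j%:R * (T / N%:R).

Lemma node_itv (T : R) N j : 0 < T -> (0 < N)%N -> (j <= N)%N ->
  T <= node T N j <= 2 * T.
Proof.
move=> T0 N0 jN; have N1 : 0 < N%:R :> R by rewrite ltr0n.
have h : 0 <= j%:R * (T / N%:R) by rewrite mulr_ge0 // divr_ge0 // ltW.
have h2 : j%:R * (T / N%:R) <= T.
  by rewrite mulrCA ler_piMr ?(ltW T0) // ler_pdivrMr // mul1r ler_nat.
rewrite /node; apply/andP; split; lra.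
Qed.

(** On each cell the mean value theorem gives the increment of H as a value of D, which differs from
    the value at the left node by at most e. *)
Lemma riemann_sum_deriv H D (T e del : R) (N : nat) :
  0 < T -> (0 < N)%N -> T / N%:R < del ->
  (forall t, T <= t <= 2 * T -> is_derive t 1 H (D t)) ->
  (forall t u, T <= t <= 2 * T -> T <= u <= 2 * T -> `|u - t| < del ->
     `|D u - D t| <= e) ->
  `|H (2 * T) - H T - \sum_(j < N) T / N%:R * D (node T N j)| <= T * e.
Proof.
move=> T0 N0 Tdel HD De; have N1 : 0 < N%:R :> R by rewrite ltr0n.
have step0 : 0 < T / N%:R by rewrite divr_gt0.
have -> : H (2 * T) - H T = \sum_(j < N) (H (node T N j.+1) - H (node T N j)).
  rewrite -(big_mkord xpredT (fun j => H (node T N j.+1) - H (node T N j))).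
  rewrite telescope_sumr // /node mul0r addr0 mulrCA divff ?mulr1 ?gt_eqF //.
  by rewrite mulr2n mulrDl mul1r.
rewrite -sumrB; apply: le_trans (ler_norm_sum _ _ _) _.
have -> : T * e = \sum_(j < N) (T / N%:R * e).
  by rewrite sumr_const card_ord -[RHS]mulr_natl; field; rewrite gt_eqF.
apply: ler_sum => j _.
have nE : node T N j.+1 = node T N j + T / N%:R.
  by rewrite /node -[j.+1]addn1 natrD mulrDl mul1r addrA.
have /andP[n1 n2] := node_itv T0 N0 (ltnW (ltn_ord j)).
have /andP[n3 n4] := node_itv T0 N0 (ltn_ord j).
have inside (t : R) : t \in `[node T N j, node T N j.+1] -> T <= t <= 2 * T.
  rewrite in_itv /= => /andP[t1 t2].
  by rewrite (le_trans n1 t1) (le_trans t2 n4).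
have lej : node T N j <= node T N j.+1 by rewrite nE lerDl ltW.
have [c cj ->] : exists2 c, c \in `[node T N j, node T N j.+1] &
    H (node T N j.+1) - H (node T N j) = D c * (node T N j.+1 - node T N j).
  apply: MVT_segment => //.
    by move=> t /subset_itv_oo_cc /inside; exact: HD.
  by apply: derivable_within_continuous => t /inside /HD [].
rewrite nE [_ + _ - _]addrC addKr mulrC -mulrBr normrM (gtr0_norm step0).
rewrite ler_pM2l //; apply: De; [|exact: inside|].
  by rewrite n1 n2.
move: cj; rewrite in_itv /= nE => /andP[c1 c2].
by rewrite ger0_norm ?subr_ge0 //; lra.
Qed.

(** Compactness of [a, b] x K makes the modulus in the first variable independent of x, so that one
    mesh serves the whole cube. *)
Lemma uniform_continuity_first (D : R -> 'rV[R]_d -> R) (a b e : R)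
    (K : set 'rV[R]_d) :
  compact K -> 0 < e ->
  (forall t x, a <= t <= b -> K x ->
     {for (t, x), continuous (fun z : R * 'rV[R]_d => D z.1 z.2)}) ->
  exists2 del : R, 0 < del & forall t u x, a <= t <= b -> K x -> `|u - t| < del ->
    `|D u x - D t x| <= e.
Proof.
move=> Kc e0 Dc.
have abK : compact (`[a, b] `*` K) by apply: compact_setX => //; exact: segment_compact.
have /compact_near_coveringP := abK.
move=> /(_ R (0:R)^'+ (fun del z => forall u, `|u - z.1| < del ->
  `|D u z.2 - D z.1 z.2| <= e)) /(_ _) [].
  move=> [t x] [/= tab Kx].
  have tab' : a <= t <= b by move: tab; rewrite in_itv.
  have /cvgrPdist_le /(_ (e / 2)) := Dc t x tab' Kx.
  rewrite divr_gt0 // => /(_ isT) /nbhs_ballP[r /= r0 Hr].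
  have r2 : 0 < r / 2 by rewrite divr_gt0.
  exists (ball (t, x) (r / 2), [set del : R | del < r / 2]).
    split; first by apply/nbhs_ballP; exists (r / 2).
    exact: nbhs_right_lt.
  move=> [[t' x'] del] [/= [bt bx] del_lt] u ut.
  have h1 : `|D t x - D t' x'| <= e / 2.
    apply: (Hr (t', x')); split; apply: le_ball (bt) || apply: le_ball (bx); lra.
  have h2 : `|D t x - D u x'| <= e / 2.
    apply: (Hr (u, x')); split => /=; last by apply: le_ball bx; lra.
    move: bt; rewrite -!ball_normE /= => bt.
    have -> : t - u = (t - t') + (t' - u) by ring.
    apply: le_lt_trans (ler_normD _ _) _; rewrite (distrC t' u); lra.
  have -> : D u x' - D t' x' = - (D t x - D u x') + (D t x - D t' x') by ring.
  apply: le_trans (ler_normD _ _) _; rewrite normrN; lra.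
move=> r /= r0 H; have r2 : 0 < r / 2 by rewrite divr_gt0.
exists (r / 2) => // t u x tab Kx ut.
apply: (H (r / 2) _ r2 (t, x)) => //.
by rewrite /ball_ /= sub0r normrN gtr0_norm //; lra.
Qed.

End RiemannSums.

(** * Regularity of the dilated limit *)

Lemma powR_pred {R : realType} (t m : R) : 0 < t -> t `^ m = t `^ (m - 1) * t.
Proof.
move=> t0; rewrite -[in LHS](subrK 1 m) [LHS]powRD ?(gt_eqF t0) ?implybT //.
by rewrite powRr1 // ltW.
Qed.

Section LipschitzLimit.
Context {R : realType} {d : nat}.
Variables (V : set 'rV[R]_d) (kappa mu T0 rho C : R) (theta : 'rV[R]_d).
Variables (p q F G : 'rV[R]_d -> R) (dp ddp dq : 'I_d -> 'rV[R]_d -> R).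
Hypothesis V_open : open V.
Hypothesis rho_gt0 : 0 < rho.
Hypothesis T0_gt0 : 0 < T0.
Let cube : set 'rV[R]_d := [set x | `|x - theta| <= 2 * rho].
Hypothesis cubeV : forall tau x, T0 <= tau -> cube x -> V (tau *: x).
Hypothesis cube_enorm : forall x, cube x -> 2^-1 <= enorm x.
Hypothesis p_C1 : C1_on V p dp.
Hypothesis p_C2 : forall y, V y -> forall i, is_derive y 'e_i (dp i) (ddp i y).
Hypothesis q_C1 : C1_on V q dq.
Hypothesis p_laplacian : forall y, V y -> \sum_(i < d) ddp i y =
  2 * kappa / enorm y * (mu * q y + \sum_(i < d) y 0 i * dq i y).
Hypothesis p_asymp : forall tau x, T0 <= tau -> cube x ->
  `|tau `^ mu * p (tau *: x) - F x| <= C / tau.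
Hypothesis q_asymp : forall tau x, T0 <= tau -> cube x ->
  `|tau `^ mu * q (tau *: x) - G x| <= C / tau.

(** [p] and [q] model the real and imaginary parts of the field with its phase removed. The radial
    operator in [p_laplacian] at tau x is tau^(1 - mu) [ddil], and [ddil] is the tau-derivative of
    [dil]. *)
Let dil (tau : R) (x : 'rV[R]_d) : R := tau `^ mu * q (tau *: x).
Let ddil (tau : R) (x : 'rV[R]_d) : R := tau `^ (mu - 1) *
  (mu * q (tau *: x) + \sum_(i < d) (tau *: x) 0 i * dq i (tau *: x)).

Let nearV x : V x -> \forall z \near x, V (z : 'rV[R]_d).
Proof. by move=> Vx; apply: open_nbhs_nbhs; split. Qed.

Let is_derive_dil (tau : R) x : T0 <= tau -> cube x ->
  is_derive tau 1 (fun t => dil t x) (ddil tau x).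
Proof.
move=> T0tau cx; have tau0 := lt_le_trans T0_gt0 T0tau.
have Vt := cubeV T0tau cx.
have Dq : is_derive tau 1 (fun t => q (t *: x))
    (\sum_(i < d) x 0 i * dq i (tau *: x)).
  have H : is_derive (0 + tau *: x) x q (\sum_(i < d) x 0 i * dq i (tau *: x)).
    rewrite add0r; apply: is_derive_of_partials => i.
      by apply: filterS (nearV Vt) => z /q_C1[].
    by have [] := q_C1 Vt.
  have := is_derive_line H.
  by under eq_fun do rewrite add0r.
apply: (is_derive_eq (is_deriveM (is_derive1_powR mu tau0) Dq)).
have scaleE (u w : R) : u *: w = u * w by [].
rewrite !scaleE /ddil.
rewrite (powR_pred mu tau0).
have -> : \sum_(i < d) (tau *: x) 0 i * dq i (tau *: x) =
    tau * \sum_(i < d) x 0 i * dq i (tau *: x).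
  by rewrite mulr_sumr; apply: eq_bigr => i _; rewrite mxE mulrA.
by rewrite /=; ring.
Qed.

Let continuous_ddil (tau : R) x : T0 <= tau -> cube x ->
  {for (tau, x), continuous (fun z : R * 'rV[R]_d => ddil z.1 z.2)}.
Proof.
move=> T0tau cx; have tau0 := lt_le_trans T0_gt0 T0tau.
have Vt := cubeV T0tau cx; have [qc _ dqc] := q_C1 Vt.
have Cfst : {for (tau, x), continuous (fun z : R * 'rV[R]_d => z.1)} by exact: cvg_fst.
have Csnd : {for (tau, x), continuous (fun z : R * 'rV[R]_d => z.2)} by exact: cvg_snd.
have Cs : {for (tau, x), continuous (fun z : R * 'rV[R]_d => z.1 *: z.2)}.
  exact: continuousZ.
apply: continuousM.
  apply: (@continuous_comp _ _ _ (fun z : R * 'rV[R]_d => z.1)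
    (fun t => t `^ (mu - 1))) => //=.
  apply: differentiable_continuous; apply/derivable1_diffP.
  by have [] := is_derive1_powR (mu - 1) tau0.
apply: continuousD.
  apply: continuousM; first exact: cst_continuous.
  exact: (@continuous_comp _ _ _ (fun z : R * 'rV[R]_d => z.1 *: z.2) q).
apply: continuous_at_sum => i; apply: continuousM.
  apply: (@continuous_comp _ _ _ (fun z : R * 'rV[R]_d => z.1 *: z.2)
    (fun y : 'rV[R]_d => y 0 i)) => //; exact: coord_continuous.
exact: (@continuous_comp _ _ _ (fun z : R * 'rV[R]_d => z.1 *: z.2) (dq i)).
Qed.

Let p_dil_continuous (tau : R) x : T0 <= tau -> cube x ->
  {for x, continuous (fun z : 'rV[R]_d => p (tau *: z))}.
Proof.
move=> T0tau cx; have [pc _ _] := p_C1 (cubeV T0tau cx).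
apply: (@continuous_comp _ _ _ (fun z : 'rV[R]_d => tau *: z) p); last exact: pc.
by apply: continuousZ; [exact: cst_continuous|exact: continuous_at_id].
Qed.

(** F is not yet known to be continuous; its bound comes from the dilate at T0, which is continuous
    on the compact cube and within C / T0 of F. *)
Let F_bounded : exists M, forall x, cube x -> `|F x| <= M.
Proof.
have cp : {within cube, continuous (fun z : 'rV[R]_d => `|p (T0 *: z)|)}.
  apply: continuous_in_subspaceT => z /set_mem cz.
  apply: continuous_comp; last exact: norm_continuous.
  exact: p_dil_continuous.
have c0 : cube !=set0.
  by exists theta; rewrite /cube /= subrr normr0 mulr_ge0 // ltW.
have [c _ cmax] := EVT_max_rV c0 (@compact_cube _ _ theta (2 * rho)) cp.
exists (T0 `^ mu * `|p (T0 *: c)| + C / T0) => x cx.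
have -> : F x = T0 `^ mu * p (T0 *: x) - (T0 `^ mu * p (T0 *: x) - F x) by ring.
apply: le_trans (ler_normB _ _) _; apply: lerD; last exact: p_asymp.
rewrite normrM (ger0_norm (powR_ge0 _ _)) ler_wpM2l ?powR_ge0 //.
exact: cmax (mem_set cx).
Qed.

Section Average.
Variables (T M : R) (N : nat).
Hypothesis T0T : T0 <= T.
Hypothesis N_gt0 : (0 < N)%N.
Hypothesis F_le : forall x, cube x -> `|F x| <= M.
Hypothesis osc : forall x, cube x ->
  `|dil (2 * T) x - dil T x - \sum_(j < N) T / N%:R * ddil (node T N j) x|
  <= T * T ^- 2.

Let T_gt0 : 0 < T. Proof. exact: lt_le_trans T0T. Qed.
Let N1 : 0 < N%:R :> R. Proof. by rewrite ltr0n. Qed.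
Let C_ge0 : 0 <= C.
Proof.
have ct : cube theta by rewrite /cube /= subrr normr0 mulr_ge0 // ltW.
have := le_trans (normr_ge0 _) (p_asymp (lexx T0) ct).
by rewrite pmulr_lge0 // invr_gt0.
Qed.

Let nodeT j : (j <= N)%N -> T0 <= node T N j.
Proof. by move=> /(node_itv T_gt0 N_gt0)/andP[h _]; exact: le_trans h. Qed.
Let node_gt0 j : (j <= N)%N -> 0 < node T N j.
Proof. by move=> /nodeT; exact: lt_le_trans. Qed.

(* The weights make the node average approximate the mean in the variable 1/tau. *)
Let wt j : R := N%:R^-1 * (T / node T N j) ^+ 2.
Let avg (x : 'rV[R]_d) : R := \sum_(j < N) wt j * (node T N j `^ mu * p (node T N j *: x)).
Let total : R := \sum_(j < N) wt j.

Let wt_itv (j : 'I_N) : N%:R^-1 * 4^-1 <= wt j <= N%:R^-1.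
Proof.
have /andP[n1 n2] := node_itv T_gt0 N_gt0 (ltnW (ltn_ord j)).
have n0 := node_gt0 (ltnW (ltn_ord j)).
have h1 : T / node T N j <= 1 by rewrite ler_pdivrMr // mul1r.
have h2 : 2^-1 <= T / node T N j by rewrite ler_pdivlMr //; lra.
have h0 : 0 <= N%:R^-1 :> R by rewrite invr_ge0 ltW.
by rewrite /wt; apply/andP; split; [apply: ler_wpM2l => // | rewrite ler_piMr //]; nra.
Qed.

(** The weights are not normalized. Nodes lie between T and 2T, so T / tau lies between 1/2 and 1;
    the lower bound 1/4 is the source of the factor 4 in [average_lipschitz]. *)
Let total_itv : 4^-1 <= total <= 1.
Proof.
have S (c : R) : \sum_(j < N) N%:R^-1 * c = c.
  by rewrite sumr_const card_ord -[LHS]mulr_natl mulrA divff ?mul1r // gt_eqF.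
rewrite /total; apply/andP; split.
  by rewrite -[leLHS]S; apply: ler_sum => j _; case/andP: (wt_itv j).
rewrite -[leRHS]S; apply: ler_sum => j _; rewrite mulr1.
by case/andP: (wt_itv j).
Qed.

Let avg_close x : cube x -> `|avg x - total * F x| <= C / T.
Proof.
move=> cx; rewrite /avg /total mulr_suml -sumrB.
apply: le_trans (ler_norm_sum _ _ _) _.
apply: (@le_trans _ _ (\sum_(j < N) wt j * (C / T))).
  apply: ler_sum => j _; rewrite -mulrBr normrM.
  have w0 : 0 <= wt j by rewrite /wt mulr_ge0 ?sqr_ge0 // invr_ge0 ltW.
  rewrite (ger0_norm w0) ler_wpM2l //.
  apply: le_trans (p_asymp (nodeT (ltnW (ltn_ord j))) cx) _.
  rewrite ler_wpM2l // lef_pV2 ?posrE // ?node_gt0 ?(ltnW (ltn_ord j)) //.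
  by case/andP: (node_itv T_gt0 N_gt0 (ltnW (ltn_ord j))).
rewrite -mulr_suml -/total ler_piMl //; last by case/andP: total_itv.
by rewrite divr_ge0 // ltW.
Qed.

Let avg_bounded x : cube x -> `|avg x| <= M + C / T0.
Proof.
move=> cx; rewrite -(subrK (total * F x) (avg x)).
apply: le_trans (ler_normD _ _) _; rewrite addrC; apply: lerD; last first.
  by apply: le_trans (avg_close cx) _; rewrite ler_wpM2l // lef_pV2 ?posrE.
apply: le_trans (F_le cx); rewrite normrM ler_piMl //.
have /andP[t1 t2] := total_itv; rewrite ger0_norm //.
by apply: le_trans t1; rewrite invr_ge0.
Qed.

(** The weight cancels the tau^2 produced by the dilation, and what remains is a plain Riemann sum
    for the increment of [dil] over [T, 2T]. *)
Let lap_avg x : R := 2 * kappa / enorm x * T *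
  \sum_(j < N) T / N%:R * ddil (node T N j) x.

Let avg_symlap x : cube x -> has_symlap avg x (lap_avg x).
Proof.
move=> cx.
have x0 : 0 < enorm x by apply: lt_le_trans (cube_enorm cx); rewrite invr_gt0.
rewrite /lap_avg mulr_sumr.
apply: has_symlap_sum => j; set tau := node T N j.
have tau0 : 0 < tau by apply: node_gt0; exact: ltnW.
have Vt : V (tau *: x) by apply: cubeV => //; apply: nodeT; exact: ltnW.
have S : has_symlap p (tau *: x) (\sum_(i < d) ddp i (tau *: x)).
  apply: (@has_symlap_partials _ _ p dp) => i; last exact: p_C2.
  by apply: filterS (nearV Vt) => z /p_C1[].
have := has_symlapZ (wt j) (has_symlapZ (tau `^ mu) (has_symlap_dilate tau0 S)).
congr (has_symlap _ _ _).
rewrite p_laplacian // enormZ gtr0_norm // /wt /ddil -/tau.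
rewrite (powR_pred mu tau0).
by move: (\sum_(i < d) _) => S'; field; rewrite !gt_eqF.
Qed.

(** Both ends of the increment are within C / T of the same limit G x, and the Riemann error is 1 /
    T; multiplying by T gives 2 C + 1. The bound |x| >= 1/2 turns 2 |kappa| / |x| into at most 4
    |kappa|. *)
Let lap_avg_bounded x : cube x -> `|lap_avg x| <= 4 * `|kappa| * (2 * C + 1).
Proof.
move=> cx; have xh := cube_enorm cx.
have x0 : 0 < enorm x by apply: lt_le_trans xh; rewrite invr_gt0.
set S := \sum_(j < N) T / N%:R * ddil (node T N j) x.
have TS : T * `|S| <= 2 * C + 1.
  have -> : S = (dil (2 * T) x - G x) - (dil T x - G x)
     - (dil (2 * T) x - dil T x - S) by ring.
  have T2 : T0 <= 2 * T by have := T_gt0; have := T0T; lra.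
  have A1 := q_asymp T2 cx; have A2 := q_asymp T0T cx.
  have A3 := osc cx.
  have A4 : C / (2 * T) <= C / T.
    by rewrite ler_wpM2l // lef_pV2 ?posrE ?mulr_gt0 //; have := T_gt0; lra.
  have A5 : T * T ^- 2 = T^-1 by field; rewrite gt_eqF.
  rewrite A5 -/S in A3.
  rewrite mulrC -ler_pdivlMr //.
  have -> : (2 * C + 1) / T = C / T + C / T + T^-1 by field; rewrite gt_eqF.
  apply: le_trans (ler_normB _ _) _; apply: lerD => //.
  apply: le_trans (ler_normB _ _) _; apply: lerD => //.
  exact: le_trans A4.
rewrite /lap_avg -/S !normrM normfV (gtr0_norm x0) (gtr0_norm T_gt0) -mulrA.
rewrite ler_pM ?mulr_ge0 ?invr_ge0 // ?(ltW T_gt0) ?(ltW x0) //.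
rewrite normr_nat mulrAC ler_wpM2r // ler_pdivrMr //; lra.
Qed.

Lemma average_lipschitz y : `|y - theta| <= rho ->
  `|F y - F theta| <= 4 * (poisson_cst (d := d) rho (M + C / T0)
     (4 * `|kappa| * (2 * C + 1) + 1) * `|y - theta| + 2 * (C / T)).
Proof.
move=> yr.
have B := @poisson_lipschitz R d avg theta rho (M + C / T0)
  (4 * `|kappa| * (2 * C + 1) + 1) rho_gt0.
have {}B : `|avg y - avg theta| <= poisson_cst (d := d) rho (M + C / T0)
     (4 * `|kappa| * (2 * C + 1) + 1) * `|y - theta|.
  apply: B => //.
  - move=> x cx; apply: continuous_at_sum => j.
    apply: continuousM; first exact: cst_continuous.
    apply: continuousM; first exact: cst_continuous.
    by apply: p_dil_continuous => //; apply: nodeT; exact: ltnW.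
  (* The tolerance 1 in the symmetric Laplacian is the final + 1 of the constant. *)
  - move=> x cx; apply: filterS (avg_symlap cx ltr01) => t H.
    rewrite -(subrK (lap_avg x * t ^+ 2) (symlap _ _ _)).
    apply: le_trans (ler_normD _ _) _; rewrite mulrDl addrC.
    apply: lerD => //; rewrite normrM (ger0_norm (sqr_ge0 t)).
    by rewrite ler_wpM2r ?sqr_ge0 // lap_avg_bounded.
have cy : cube y by apply: le_trans yr _; have := rho_gt0; lra.
have ct : cube theta by rewrite /cube /= subrr normr0 mulr_ge0 // ltW.
have Ay := avg_close cy; have At := avg_close ct.
have /andP[t1 _] := total_itv.
have t0 : 0 < total by apply: lt_le_trans t1; rewrite invr_gt0.
have h : total * `|F y - F theta| <= poisson_cst (d := d) rho (M + C / T0)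
     (4 * `|kappa| * (2 * C + 1) + 1) * `|y - theta| + 2 * (C / T).
  rewrite -[X in X * _](gtr0_norm t0) -normrM.
  have -> : total * (F y - F theta) =
    (avg y - avg theta) - (avg y - total * F y) + (avg theta - total * F theta) by ring.
  apply: le_trans (ler_normD _ _) _.
  by have := ler_normB (avg y - avg theta) (avg y - total * F y); lra.
have := normr_ge0 (F y - F theta); nra.
Qed.

End Average.

(** The Lipschitz constant of the averages does not depend on T, so the error 8 C / T is removed by
    letting T grow. *)
Lemma lipschitz_limit : exists2 L : R, 0 <= L &
  forall y, `|y - theta| <= rho -> `|F y - F theta| <= L * `|y - theta|.
Proof.
have [M FM] := F_bounded.
set L := poisson_cst (d := d) rho (M + C / T0) (4 * `|kappa| * (2 * C + 1) + 1).
suff H y : `|y - theta| <= rho -> `|F y - F theta| <= 4 * L * `|y - theta|.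
  exists `|4 * L| => // y yr; apply: le_trans (H y yr) _.
  by rewrite ler_wpM2r // ler_norm.
move=> yr; apply/ler_addgt0Pr => e e0.
set T := Num.max T0 (8 * `|C| / e).
have T0T : T0 <= T by rewrite le_max lexx.
have T0' : 0 < T by exact: lt_le_trans T0T.
have Te : 8 * (C / T) <= e.
  rewrite mulrA ler_pdivrMr // -ler_pdivrMl // [leLHS]mulrC.
  apply: (@le_trans _ _ (8 * `|C| / e)).
    by rewrite ler_pM2r ?invr_gt0 // ler_pM2l // ler_norm.
  by rewrite /T le_max lexx orbT.
(* The tolerance T^-2 for the oscillation of [ddil] on a cell makes the Riemann error over an
   interval of length T equal to 1 / T, the order of the asymptotic error. *)
have Ti2 : 0 < T ^- 2 by rewrite invr_gt0 exprn_gt0.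
have Tle (t : R) : T <= t <= 2 * T -> T0 <= t by case/andP => /(le_trans T0T).
have [del del0 Hdel] := uniform_continuity_first (a := T) (b := 2 * T)
  (@compact_cube _ _ theta (2 * rho)) Ti2
  (fun t x tT cx => continuous_ddil (Tle t tT) cx).
pose N := (Num.truncn (T / del)).+1.
have Ndel : T / N%:R < del.
  by rewrite ltr_pdivrMr // mulrC -ltr_pdivrMr // Num.Theory.truncnS_gt.
have osc x : cube x ->
  `|dil (2 * T) x - dil T x - \sum_(j < N) T / N%:R * ddil (node T N j) x|
  <= T * T ^- 2.
  move=> cx; apply: (@riemann_sum_deriv _ (dil ^~ x) (ddil ^~ x) T _ del) => //.
    by move=> t /Tle tT; exact: is_derive_dil.
  by move=> t u tT _ ut; exact: Hdel.
have := average_lipschitz T0T (ltn0Sn _) FM osc yr.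
rewrite -/L; lra.
Qed.

End LipschitzLimit.

(** * Exterior domains and complex moduli *)

Section Exterior.
Context {R : realType} {d : nat}.
Implicit Types (x y : 'rV[R]_d) (A U : set 'rV[R]_d).

Lemma exterior_far A : bounded_set A ->
  exists r : R, forall x, r < enorm x -> exterior A x.
Proof.
move=> [M [_ HM]].
have AM x : A x -> `|x| <= M + 1 by apply: HM; rewrite ltrDl.
have clA : closure A `<=` [set x | `|x - 0| <= M + 1].
  rewrite (proj1 (closure_id _) (@closed_cube R d 0 (M + 1))).
  by apply: closureS => x /AM; rewrite /= subr0.
exists (d%:R * (M + 1)) => x; rewrite ltNge => /negP xr Ax; apply: xr.
apply: le_trans (enorm_le_norm x) _; rewrite ler_wpM2l //.
have : closure A x by case: Ax => [/subset_closure|[]].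
by move=> /clA; rewrite /= subr0.
Qed.

Lemma Ck2_helmholtz_on U V (a : 'rV[R]_d -> R) kappa : V `<=` U -> Ck 2 U a ->
  (forall x, U x -> \sum_(i < d) partial i (partial i a) x = - kappa ^+ 2 * a x) ->
  helmholtz_on kappa V a (fun i => partial i a) (fun i => partial i (partial i a)).
Proof.
move=> VU [ac ad] lap; split=> y /VU Uy.
  split; first exact: ac.
    by move=> i; apply: derivableP; have [] := ad i; move=> /(_ y Uy).
  by move=> i; have [_ []] := ad i; move=> /(_ y Uy).
split=> [i|]; last exact: lap.
by apply: derivableP; have [_ [_ /(_ i)[]]] := ad i; move=> /(_ y Uy).
Qed.

End Exterior.

Section ComplexModulus.
Context {R : realType}.
Implicit Types (z w : R[i]) (t s : R).

Lemma cmodM z w : cmod (z * w) = cmod z * cmod w.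
Proof. exact: Normc.normcM. Qed.

Lemma cmodV z : cmod z^-1 = (cmod z)^-1.
Proof. exact: Normc.normcV. Qed.

Lemma cmodD z w : cmod (z + w) <= cmod z + cmod w.
Proof. exact: le_normcD. Qed.

Lemma cmodN z : cmod (- z) = cmod z.
Proof. exact: normcN. Qed.

Lemma cmod_ge0 z : 0 <= cmod z.
Proof. by case: z => a b; exact: sqrtr_ge0. Qed.

Lemma cmod_real t : cmod (t%:C)%C = `|t|.
Proof. by rewrite /cmod /= expr0n /= addr0 sqrtr_sqr. Qed.

Lemma cmodJ z : cmod (z^*)%C = cmod z.
Proof. by case: z => a b; rewrite /cmod /= sqrrN. Qed.

Lemma cmod_expi t : cmod (expi t) = 1.
Proof. by rewrite /cmod /= cos2Dsin2 sqrtr1. Qed.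

Lemma cmod_sqr z : ((cmod z ^+ 2)%:C)%C = z * (z^*)%C.
Proof.
case: z => a b; rewrite /cmod /= sqr_sqrtr ?addr_ge0 ?sqr_ge0 //.
by apply/eqP; rewrite eq_complex /=; apply/andP; split; apply/eqP; ring.
Qed.

Lemma Re_le_cmod z : `|complex.Re z| <= cmod z.
Proof.
case: z => a b; rewrite /cmod /=.
by rewrite -sqrtr_sqr ler_wsqrtr // lerDl sqr_ge0.
Qed.

Lemma Im_le_cmod z : `|complex.Im z| <= cmod z.
Proof.
case: z => a b; rewrite /cmod /=.
by rewrite -sqrtr_sqr ler_wsqrtr // lerDr sqr_ge0.
Qed.

Lemma cmod_le_ReIm z : cmod z <= `|complex.Re z| + `|complex.Im z|.
Proof.
case: z => a b; rewrite /cmod /=.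
rewrite -ler_sqr ?nnegrE ?sqrtr_ge0 ?addr_ge0 // sqr_sqrtr ?addr_ge0 ?sqr_ge0 //.
rewrite -(real_normK (num_real a)) -(real_normK (num_real b)).
have := mulr_ge0 (normr_ge0 a) (normr_ge0 b); nra.
Qed.

Lemma expiD s t : expi (s + t) = expi s * expi t.
Proof. by rewrite /expi cosD sinD; apply/eqP; rewrite eq_complex /= eqxx [X in _ == X]addrC eqxx. Qed.

Lemma expiN t : expi (- t) = ((expi t)^*)%C.
Proof. by rewrite /expi cosN sinN. Qed.

Lemma expiJM t : (expi t)^*%C * expi t = 1.
Proof. by rewrite -expiN -expiD addNr /expi cos0 sin0. Qed.

Lemma Re_sum (I : finType) (F : I -> R[i]) :
  complex.Re (\sum_i F i) = \sum_i complex.Re (F i).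
Proof. by elim/big_rec2: _ => //= i y1 y2 _ <-; case: (F i) y2 => ? ? []. Qed.

Lemma Im_sum (I : finType) (F : I -> R[i]) :
  complex.Im (\sum_i F i) = \sum_i complex.Im (F i).
Proof. by elim/big_rec2: _ => //= i y1 y2 _ <-; case: (F i) y2 => ? ? []. Qed.

End ComplexModulus.

(** * Regularity of the far field *)

Section FarFieldLipschitz.
Context {R : realType} {d : nat}.
Implicit Types (x y : 'rV[R]_d) (psi f : 'rV[R]_d -> R[i]).

Lemma helmholtz_on_parts kappa (U V : set 'rV[R]_d) psi : V `<=` U ->
  CkC 2 U psi ->
  (forall x, U x -> - laplacian psi x = (kappa ^+ 2)%:C%C * psi x) ->
  helmholtz_on kappa V (RePart psi) (fun i => partial i (RePart psi))
    (fun i => partial i (partial i (RePart psi))) /\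
  helmholtz_on kappa V (ImPart psi) (fun i => partial i (ImPart psi))
    (fun i => partial i (partial i (ImPart psi))).
Proof.
move=> VU [CRe CIm] lap.
have E x : U x -> laplacian psi x = - ((kappa ^+ 2)%:C%C * psi x).
  by move=> /lap <-; rewrite opprK.
have CM (t : R) (z : R[i]) : complex.Re (- (t%:C%C * z)) = - t * complex.Re z /\
    complex.Im (- (t%:C%C * z)) = - t * complex.Im z.
  by case: z => a b /=; split; ring.
split; apply: (Ck2_helmholtz_on VU) => // x Ux.
  have := congr1 (@complex.Re R) (E x Ux); rewrite (CM _ _).1 => <-.
  by rewrite /laplacian Re_sum.
have := congr1 (@complex.Im R) (E x Ux); rewrite (CM _ _).2 => <-.
by rewrite /laplacian Im_sum.
Qed.

Lemma twist_conj kappa psi y :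
  (expi (kappa * enorm y))^*%C * psi y =
  (twist kappa (RePart psi) (ImPart psi) y +i*
   twist kappa (ImPart psi) (fun z => - RePart psi z) y)%C.
Proof.
rewrite /twist /RePart /ImPart /expi; case: (psi y) => a b /=.
by apply/eqP; rewrite eq_complex /=; apply/andP; split; apply/eqP; ring.
Qed.

(* Dilating by tau and multiplying by tau^mu freezes the leading term. *)
Lemma dilated_far_field kappa mu psi f (C tau : R) x :
  0 < tau -> 2^-1 <= enorm x ->
  0 <= mu -> 0 <= C ->
  cmod (psi (tau *: x) - expi (kappa * enorm (tau *: x))
      / (enorm (tau *: x) `^ mu)%:C%C * f ((enorm (tau *: x))^-1 *: (tau *: x)))
    <= C / enorm (tau *: x) `^ (mu + 1) ->
  cmod ((tau `^ mu)%:C%C * ((expi (kappa * enorm (tau *: x)))^*%C * psi (tau *: x))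
     - (enorm x `^ (- mu))%:C%C * f ((enorm x)^-1 *: x))
  <= C * 2 `^ (mu + 1) / tau.
Proof.
move=> tau0 xh mu0 C0; have x0 : 0 < enorm x by apply: lt_le_trans xh; rewrite invr_gt0.
have tx0 : 0 < tau * enorm x by rewrite mulr_gt0.
rewrite enormZ gtr0_norm //.
have -> : (tau * enorm x)^-1 *: (tau *: x) = (enorm x)^-1 *: x.
  by rewrite scalerA invfM mulrAC mulVf ?mul1r // gt_eqF.
set e := expi _; set g := f _; move=> H.
have ee : e^*%C * e = 1 by exact: expiJM.
have -> : (tau `^ mu)%:C%C * (e^*%C * psi (tau *: x)) - (enorm x `^ (- mu))%:C%C * g
   = (tau `^ mu)%:C%C * e^*%C * (psi (tau *: x) - e / ((tau * enorm x) `^ mu)%:C%C * g).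
  have -> : (enorm x `^ (- mu))%:C%C =
      (tau `^ mu)%:C%C * (e^*%C * e) / ((tau * enorm x) `^ mu)%:C%C :> R[i].
    rewrite ee mulr1 -fmorphV -rmorphM /=; congr (_%:C)%C.
    rewrite powRM ?ltW // powRN invfM mulrA divff ?mul1r //.
    by rewrite gt_eqF // powR_gt0.
  by ring.
rewrite !cmodM cmodJ cmod_expi mulr1 cmod_real ger0_norm ?powR_ge0 //.
apply: le_trans (ler_wpM2l (powR_ge0 _ _) H) _.
rewrite powRM ?(ltW tau0) ?(ltW x0) // invfM.
have m1 : mu + 1 != 0 by rewrite gt_eqF // ltr_wpDl.
have -> : tau `^ mu * (C * ((tau `^ (mu + 1))^-1 * (enorm x `^ (mu + 1))^-1)) =
   C * (enorm x `^ (mu + 1))^-1 / tau.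
  rewrite [tau `^ (mu + 1)]powR_pred // addrK.
  by field; rewrite !gt_eqF // powR_gt0.
(* Here |x| >= 1/2 costs the factor 2^(mu + 1). *)
rewrite ler_wpM2r ?invr_ge0 ?(ltW tau0) // ler_wpM2l //.
rewrite -div1r ler_pdivrMr ?powR_gt0 // -powRM ?(ltW x0) //.
have one : 1 `^ (mu + 1) = 1 :> R by rewrite powR1.
rewrite -[X in X <= _]one ge0_ler_powR ?nnegrE //; [by rewrite addr_ge0| |lra].
by rewrite mulr_ge0 // ltW.
Qed.

Lemma far_field_lipschitz (d_gt1 : (1 < d)%N) (Omega : set 'rV[R]_d) kappa psi f theta :
  bounded_set Omega ->
  CkC 2 (exterior Omega) psi ->
  (forall x, exterior Omega x -> - laplacian psi x = (kappa ^+ 2)%:C%C * psi x) ->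
  far_field_pattern kappa (exterior Omega) psi f ->
  sphere theta ->
  exists L rho : R, [/\ 0 <= L, 0 < rho &
    forall phi, sphere phi -> enorm (phi - theta) <= rho ->
      cmod (f phi - f theta) <= L * enorm (phi - theta)].
Proof.
move=> Obd psiC2 psiH [C [r1 [C0 r10 far]]] th1.
have [r2 Hext] := exterior_far Obd.
set r0 : R := Num.max r1 r2.
pose V := [set y : 'rV[R]_d | r0 < enorm y].
have Vop : open V by exact: open_enorm_gt.
have VU : V `<=` exterior Omega.
  by move=> y Vy; apply: Hext; apply: le_lt_trans Vy; rewrite le_max lexx orbT.
have r00 : 0 < r0 by rewrite lt_max r10.
have V0 y : V y -> 0 < enorm y by exact: lt_trans.
have [Ha Hb] := helmholtz_on_parts VU psiC2 psiH.
have Hna := helmholtz_onN Ha; have Hnb := helmholtz_onN Hb.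
set a := RePart psi in Ha Hna *; set b := ImPart psi in Hb Hnb *.
pose mu : R := (d%:R - 1) / 2.
have d1 : 1 < d%:R :> R by rewrite ltr1n.
have mu0 : 0 <= mu by rewrite /mu divr_ge0 // subr_ge0 ltW.
(* The sup-norm cube of radius 2 rho lies in the Euclidean ball of radius 1/2 about theta, hence
   keeps |x| >= 1/2. *)
pose rho : R := (4 * d%:R)^-1.
have rho0 : 0 < rho by rewrite invr_gt0 mulr_gt0 // (lt_trans _ d1).
(* With |x| >= 1/2 this gives |tau x| >= r0 + 1 for tau >= T0. *)
pose T0 := 2 * r0 + 2.
have T00 : 0 < T0 by rewrite /T0 addr_gt0 // mulr_gt0.
have cubeh x : `|x - theta| <= 2 * rho -> 2^-1 <= enorm x.
  move=> xt; have h1 := enorm_le_norm (x - theta).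
  have h2 : d%:R * `|x - theta| <= 2^-1.
    have -> : 2^-1 = d%:R * (2 * rho) :> R.
      by rewrite /rho; field; rewrite gt_eqF // (lt_trans _ d1).
    by rewrite ler_wpM2l.
  have h3 := enorm_triangle x (theta - x).
  rewrite addrC subrK -opprB enormN th1 in h3.
  lra.
have cubeV tau x : T0 <= tau -> `|x - theta| <= 2 * rho -> V (tau *: x).
  move=> Ttau /cubeh xh; have tau0 := lt_le_trans T00 Ttau.
  by rewrite /V /= enormZ gtr0_norm //; move: Ttau; rewrite /T0; nra.
have mu1 : (d%:R + 1) / 2 = mu + 1 :> R by rewrite /mu; field.
(* The extension of f that is homogeneous of degree -mu; it agrees with f on the unit sphere, so a
   Lipschitz bound in space restricts to one for f. *)
pose F x := (enorm x `^ (- mu))%:C%C * f ((enorm x)^-1 *: x).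
pose C' := C * 2 `^ (mu + 1).
have main tau x : T0 <= tau -> `|x - theta| <= 2 * rho ->
   cmod ((tau `^ mu)%:C%C * (twist kappa a b (tau *: x) +i*
     twist kappa b (fun z => - a z) (tau *: x))%C - F x) <= C' / tau.
  move=> Ttau xt; rewrite -twist_conj.
  apply: dilated_far_field => //; first exact: lt_le_trans Ttau.
  - exact: cubeh.
  - exact: ltW.
  - rewrite -mu1; apply: far; first exact: VU (cubeV _ _ Ttau xt).
    by apply: ltW; apply: le_lt_trans (cubeV _ _ Ttau xt); rewrite le_max lexx.
have reim (t u v : R) (z : R[i]) (B : R) : cmod (t%:C%C * (u +i* v)%C - z) <= B ->
   `|t * u - complex.Re z| <= B /\ `|t * v - complex.Im z| <= B.
  move=> H; split.
    apply: le_trans H; apply: le_trans (Re_le_cmod _).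
    by case: z => z1 z2 /=; rewrite mul0r subr0.
  apply: le_trans H; apply: le_trans (Im_le_cmod _).
  by case: z => z1 z2 /=; rewrite mul0r addr0.
have asP tau x (h1 : T0 <= tau) (h2 : `|x - theta| <= 2 * rho) :=
  (reim _ _ _ _ _ (main tau x h1 h2)).1.
have asQ tau x (h1 : T0 <= tau) (h2 : `|x - theta| <= 2 * rho) :=
  (reim _ _ _ _ _ (main tau x h1 h2)).2.
have asNP tau x (h1 : T0 <= tau) (h2 : `|x - theta| <= 2 * rho) :
   `|tau `^ mu * twist kappa (fun z => - a z) (fun z => - b z) (tau *: x)
     - - complex.Re (F x)| <= C' / tau.
  have -> : twist kappa (fun z => - a z) (fun z => - b z) (tau *: x) =
    - twist kappa a b (tau *: x) by rewrite /twist; ring.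
  by rewrite mulrN -opprD normrN; exact: asP.
have twC1 := @C1_twist R d kappa V.
have twD2 a1 b1 da db dda ddb (h1 : helmholtz_on kappa V a1 da dda)
    (h2 : helmholtz_on kappa V b1 db ddb) y (Vy : V y) i :=
  is_derive_twistD i (V0 y Vy) Vy h1 h2.
have twL a1 b1 da db dda ddb (h1 : helmholtz_on kappa V a1 da dda)
    (h2 : helmholtz_on kappa V b1 db ddb) y (Vy : V y) :=
  laplacian_twist (V0 y Vy) Vy h1 h2.
have [L1 L10 H1] := lipschitz_limit Vop rho0 T00 cubeV cubeh
  (twC1 _ _ _ _ V0 Ha.1 Hb.1) (twD2 _ _ _ _ _ _ Ha Hb) (twC1 _ _ _ _ V0 Hb.1 Hna.1)
  (twL _ _ _ _ _ _ Ha Hb) asP asQ.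
have [L2 L20 H2] := lipschitz_limit Vop rho0 T00 cubeV cubeh
  (twC1 _ _ _ _ V0 Hb.1 Hna.1) (twD2 _ _ _ _ _ _ Hb Hna) (twC1 _ _ _ _ V0 Hna.1 Hnb.1)
  (twL _ _ _ _ _ _ Hb Hna) asQ asNP.
exists (L1 + L2), rho; split=> // [|phi ph1 pr]; first exact: addr_ge0.
have Fs z : sphere z -> F z = f z.
  by move=> z1; rewrite /F z1 powR1 invr1 scale1r mul1r.
have pn := norm_le_enorm (phi - theta).
have pr' := le_trans pn pr.
rewrite -!Fs //; apply: le_trans (cmod_le_ReIm _) _.
have := H1 phi pr'; have := H2 phi pr'.
case: (F phi) => p1 p2; case: (F theta) => q1 q2 /= B2 B1.
apply: le_trans (lerD B1 B2) _; rewrite -mulrDl.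
by rewrite ler_wpM2l // addr_ge0.
Qed.

End FarFieldLipschitz.

(** * The two-point formula *)

Lemma sigma_ge0 (R : realType) d : 0 <= sigma R d.
Proof. by rewrite /sigma; case: ifP => _; lra. Qed.

Lemma sigma_le1 (R : realType) d : sigma R d <= 1.
Proof. by rewrite /sigma; case: ifP => _; lra. Qed.

(** Moves the error from |y| to |x|; the factor is 2^sigma <= 2. *)
Lemma inv_powR_sigma_le (R : realType) d (s t : R) : 0 < s -> 0 < t -> t <= 2 * s ->
  (s `^ sigma R d)^-1 <= 2 / t `^ sigma R d.
Proof.
move=> s0 t0 ts; rewrite -div1r ler_pdivrMr ?powR_gt0 //.
rewrite mulrAC ler_pdivlMr ?powR_gt0 // mul1r.
have h : t `^ sigma R d <= (2 * s) `^ sigma R d.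
  apply: ge0_ler_powR; rewrite ?nnegrE ?(ltW t0) ?sigma_ge0 //.
  exact: le_trans (ltW t0) ts.
apply: le_trans h _; rewrite powRM ?(ltW s0) // ler_wpM2r ?powR_ge0 //.
by rewrite -[leRHS]powRr1 // ler_powR ?ler1n // sigma_le1.
Qed.

Section TwoPoint.
Context {R : realType} {d : nat}.
Implicit Types (x y k : 'rV[R]_d) (psi f : 'rV[R]_d -> R[i]).

(** Expanding the intensity leaves the cross term 2 Re(e g) and two remainders: the far-field error,
    of order 1/r, and r^mu |psi|^2, of order r^-mu. As r >= 1, both are absorbed by r^-sigma because
    sigma = min(1, mu) for mu = (d - 1)/2. The far-field error and its conjugate give 2 C, and r^mu
    |psi| <= M + C gives the square. *)
Lemma holographic_expansion kappa psi k y (g : R[i]) (C M : R) :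
  (1 < d)%N -> 0 <= C -> 0 <= M -> 1 <= enorm y -> cmod g <= M ->
  cmod (psi y - expi (kappa * enorm y) / (enorm y `^ ((d%:R - 1) / 2))%:C%C * g)
    <= C / enorm y `^ ((d%:R + 1) / 2) ->
  forall e, e = expi (kappa * enorm y - dot k y) ->
  cmod ((holographic_data psi y k)%:C%C - (e * g + (e * g)^*%C))
    <= (2 * C + (M + C) ^+ 2) / enorm y `^ sigma R d.
Proof.
move=> d1 C0 M0 y1 gM H e eq_e.
set mu : R := (d%:R - 1) / 2 in H *.
have mu1 : (d%:R + 1) / 2 = mu + 1 :> R by rewrite /mu; field.
have y0 : 0 < enorm y by exact: lt_le_trans y1.
rewrite mu1 (powR_pred (mu + 1) y0) addrK in H.
set r := enorm y in y1 y0 H eq_e *.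
set rh := r `^ mu in H *.
have rh0 : 0 < rh by exact: powR_gt0.
have rhn : (rh%:C)%C != 0 :> R[i] by rewrite (inj_eq (@complexI R)) gt_eqF.
set et := psi y - _ in H.
have psiE : psi y = expi (kappa * r) / rh%:C%C * g + et.
  by rewrite /et addrC subrK.
pose p0 := expi (dot k y).
have eE : e = p0^*%C * expi (kappa * r) by rewrite eq_e expiD expiN mulrC.
have p01 : p0 * p0^*%C = 1 by rewrite mulrC; exact: expiJM.
have aE : (holographic_data psi y k)%:C%C =
    rh%:C%C * ((p0 + psi y) * (p0 + psi y)^*%C - 1).
  rewrite /holographic_data -/r -/mu -/rh /intensity rmorphM rmorphB /= cmod_sqr.
  by rewrite rmorph1.
have -> : (holographic_data psi y k)%:C%C - (e * g + (e * g)^*%C) =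
   rh%:C%C * (p0^*%C * et) + (rh%:C%C * (p0^*%C * et))^*%C
   + rh%:C%C * (psi y * (psi y)^*%C).
  have -> : rh%:C%C * (p0^*%C * et) = rh%:C%C * (p0^*%C * psi y) - e * g.
    by rewrite eE psiE; field.
  have conjB (u v : R[i]) : (u - v)^*%C = u^*%C - v^*%C by exact: rmorphB.
  have conjD (u v : R[i]) : (u + v)^*%C = u^*%C + v^*%C by exact: rmorphD.
  have conjM (u v : R[i]) : (u * v)^*%C = u^*%C * v^*%C by exact: rmorphM.
  rewrite aE conjB conjD (conjM (rh%:C)%C) (conjM (p0^*%C)) conjcK conjc_real.
  have -> : (p0 + psi y) * (p0^*%C + (psi y)^*%C) - 1 = p0 * (psi y)^*%C
     + p0^*%C * psi y + psi y * (psi y)^*%C + (p0 * p0^*%C - 1) by ring.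
  by rewrite p01 subrr addr0; ring.
have etb : rh * cmod et <= C / r.
  move: H; rewrite invfM mulrA => H.
  apply: le_trans (ler_wpM2l (ltW rh0) H) _.
  by rewrite le_eqVlt; apply/orP; left; apply/eqP; field; rewrite !gt_eqF.
have psib : rh * cmod (psi y) <= M + C.
  rewrite psiE; apply: le_trans (ler_wpM2l (ltW rh0) (cmodD _ _)) _.
  rewrite mulrDr; apply: lerD; last first.
    by apply: le_trans etb _; rewrite ler_pdivrMr // ler_peMr.
  rewrite !cmodM cmodV cmod_expi mul1r cmod_real ger0_norm ?(ltW rh0) //.
  by rewrite mulrA divff ?mul1r // gt_eqF.
have sle (s t : R) : s <= t -> r `^ s <= r `^ t by move=> st; apply: ler_powR.
have s1 := sigma_le1 R d.
have smu : sigma R d <= mu.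
  rewrite /sigma /mu; case: ifPn => [/eqP ->|d2]; first by lra.
  have : 3 <= d%:R :> R by rewrite ler_nat ltn_neqAle eq_sym d2 d1.
  by lra.
have rs0 : 0 < r `^ sigma R d by exact: powR_gt0.
have ir : r^-1 <= (r `^ sigma R d)^-1.
  by rewrite lef_pV2 ?posrE // -[X in _ <= X]powRr1 ?(ltW y0) // sle.
have irh : rh^-1 <= (r `^ sigma R d)^-1 by rewrite lef_pV2 ?posrE // sle.
apply: le_trans (cmodD _ _) _; rewrite mulrDl; apply: lerD.
  apply: le_trans (cmodD _ _) _; rewrite cmodJ !cmodM cmodJ cmod_expi mul1r.
  rewrite cmod_real ger0_norm ?(ltW rh0) //.
  have : C / r <= C / r `^ sigma R d by rewrite ler_wpM2l.
  lra.
rewrite !cmodM cmodJ cmod_real ger0_norm ?(ltW rh0) //.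
have -> : rh * (cmod (psi y) * cmod (psi y)) = (rh * cmod (psi y)) ^+ 2 / rh.
  by field; rewrite gt_eqF.
apply: ler_pM => //; first exact: sqr_ge0.
  by rewrite invr_ge0 ltW.
by rewrite ler_sqr ?nnegrE // ?addr_ge0 // mulr_ge0 ?cmod_ge0 // ltW.
Qed.

(** The difference of directions is z/|x| plus (1/|y| - 1/|x|) y, with y = x + z; each has norm at
    most |z|/|x|. *)
Lemma unit_direction_dist x z : 0 < enorm x -> 0 < enorm (x + z) ->
  enorm ((enorm (x + z))^-1 *: (x + z) - (enorm x)^-1 *: x)
    <= 2 * (enorm z / enorm x).
Proof.
move=> x0 y0; set y := x + z.
have -> : (enorm y)^-1 *: y - (enorm x)^-1 *: x =
   (enorm x)^-1 *: z + ((enorm y)^-1 - (enorm x)^-1) *: y.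
  by apply/rowP => j; rewrite !mxE; ring.
apply: le_trans (enorm_triangle _ _) _.
have -> : 2 * (enorm z / enorm x) = enorm z / enorm x + enorm z / enorm x by ring.
rewrite !enormZ; apply: lerD.
  by rewrite ger0_norm ?invr_ge0 ?(ltW x0) // mulrC.
have -> : (enorm y)^-1 - (enorm x)^-1 = (enorm x - enorm y) / (enorm x * enorm y).
  by field; rewrite !gt_eqF.
rewrite normrM normfV (ger0_norm (mulr_ge0 (ltW x0) (ltW y0))).
have -> : `|enorm x - enorm y| / (enorm x * enorm y) * enorm y =
   `|enorm x - enorm y| / enorm x by field; rewrite !gt_eqF.
rewrite ler_wpM2r ?invr_ge0 ?(ltW x0) // ler_norml.
have h1 : enorm y <= enorm x + enorm z by exact: enorm_triangle.
have h2 : enorm x <= enorm y + enorm z.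
  rewrite -{1}(addrK z x) -[enorm z]enormN; exact: enorm_triangle.
by apply/andP; split; lra.
Qed.

(* The two unknowns g and g^* are eliminated between the data at x and at y. *)
Lemma two_point_elimination (ex ey g ax ay rx ry D : R[i]) :
  ax = ex * g + (ex * g)^*%C + rx -> ay = ey * g + (ey * g)^*%C + ry ->
  D = ey^*%C * ex - ex^*%C * ey -> D != 0 ->
  g = D^-1 * (ey^*%C * ax - ex^*%C * ay) + D^-1 * (ex^*%C * ry - ey^*%C * rx).
Proof.
move=> -> -> DE D0; rewrite -mulrDr; apply: (mulfI D0); rewrite mulVKf //.
rewrite DE !rmorphM /=; ring.
Qed.

(** [Dfun] is the determinant of the linear system for g and its conjugate formed by the leading
    terms of the data at x and at x + z. *)
Lemma Dfun_expi x z k kappa : enorm k = kappa ->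
  let al := expi (kappa * enorm x - dot k x) in
  let be := expi (kappa * enorm (x + z) - dot k (x + z)) in
  Dfun x z k = be^*%C * al - al^*%C * be.
Proof.
move=> kk al be; rewrite /Dfun /al /be -!expiN -!expiD kk.
set t := dot k z + _ - _.
have -> : - (kappa * enorm (x + z) - dot k (x + z)) + (kappa * enorm x - dot k x) = t.
  by rewrite /t dotDr; ring.
have -> : - (kappa * enorm x - dot k x) + (kappa * enorm (x + z) - dot k (x + z)) = - t.
  by rewrite /t dotDr; ring.
rewrite /expi cosN sinN /imI.
by apply/eqP; rewrite eq_complex /=; apply/andP; split; apply/eqP; ring.
Qed.

End TwoPoint.

Theorem theorem2p1 (R : realType) (d : nat) (d_ge2 : (2 <= d)%N)
    (Omega : set 'rV[R]_d)
    (Omega_dom : smooth_bounded_domain Omega)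
    (U_connected : connected (exterior Omega))
    (kappa : R) (kappa_gt0 : 0 < kappa)
    (k : 'rV[R]_d) (k_norm : enorm k = kappa)
    (psi1 : 'rV[R]_d -> R[i])
    (psi1_rad : radiation_solution kappa (exterior Omega) psi1)
    (f1 : 'rV[R]_d -> R[i])
    (f1_far : far_field_pattern kappa (exterior Omega) psi1 f1)
    (omega : 'rV[R]_d) (omega_sphere : sphere omega)
    (theta : 'rV[R]_d) (theta_half : half_sphere omega theta) :
  exists C r : R, [/\ 0 < C, 0 < r &
    forall (s : R) (zeta : 'rV[R]_d),
      let x := (s / dot theta omega) *: theta in
      0 <= s ->
      hyperplane s omega `<=` exterior Omega ->
      hyperplane 0 omega zeta ->
      Dfun x zeta k != 0 ->
      r <= enorm x ->
      r <= enorm x / enorm zeta ->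
      exists E1 E2 : R[i],
        [/\ f1 theta = f11 psi1 x zeta k + (Dfun x zeta k)^-1 * (E1 + E2),
            cmod E1 <= C / enorm x `^ sigma R d
          & cmod E2 <= C * (enorm zeta / enorm x)]].
Proof.
have [_ _ _ Obd _] := Omega_dom; have [psiC2 psiH _] := psi1_rad.
have [th1 thw] := theta_half.
have [L [rho [L0 rho0 Lip]]] := far_field_lipschitz d_ge2 Obd psiC2 psiH f1_far th1.
have [C [r1 [C0 r10 far]]] := f1_far.
(* M bounds |f1| at every direction within rho of theta, hence at both x/|x| and y/|y|. *)
set g := f1 theta; set M := cmod g + L * rho.
have M0 : 0 <= M by rewrite addr_ge0 ?cmod_ge0 // mulr_ge0 // ltW.
set B := 2 * C + (M + C) ^+ 2.
have B0 : 0 <= B by rewrite addr_ge0 ?sqr_ge0 // mulr_ge0 // ltW.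
(* 3 B is B at x plus 2 B for the remainder at y moved to |x|; 4 L is twice the Lipschitz bound 2 L
   |zeta|/|x|. In the threshold, 2 r1 and 2 ensure |y| >= |x|/2 >= r1 and |y| >= 1, and 2 / rho
   brings y/|y| within rho of theta. *)
exists (3 * B + 4 * L + 1), (2 * r1 + 2 + 2 / rho).
have rho2 : 0 < 2 / rho by rewrite divr_gt0.
split; [lra | lra |].
move=> s zeta x s0 HX Hz D0 xr xzr.
set r := 2 * r1 + 2 + 2 / rho in xr xzr.
have [rr1 rr2 rr3] : [/\ 2 * r1 <= r, 2 <= r & 2 / rho <= r] by rewrite /r; split; lra.
have r0 : 0 < r by lra.
have c0 : 0 <= s / dot theta omega by rewrite divr_ge0 // ltW.
have xn : enorm x = s / dot theta omega.
  by rewrite enormZ (th1 : enorm theta = 1) mulr1 ger0_norm.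
have x0 : 0 < enorm x by exact: lt_le_trans xr.
have x_dir : (enorm x)^-1 *: x = theta.
  by rewrite {2}/x -xn scalerA mulVf ?scale1r // gt_eqF.
(* Division by zero returns 0, so zeta = 0 contradicts the lower bound on |x|/|zeta|. *)
have z0 : 0 < enorm zeta.
  rewrite lt_neqAle enorm_ge0 andbT eq_sym; apply/eqP => z0.
  by move: xzr; rewrite z0 invr0 mulr0 leNgt r0.
have zx : r * enorm zeta <= enorm x by rewrite -ler_pdivlMr.
set y := x + zeta.
have yx : enorm x <= 2 * enorm y.
  have := enorm_triangle y (- zeta); rewrite addrK enormN.
  have : 2 * enorm zeta <= r * enorm zeta by rewrite ler_pM2r.
  lra.
have y1 : 1 <= enorm y by lra.
have y0 : 0 < enorm y by lra.
have [x1 xr1 yr1] : [/\ 1 <= enorm x, r1 <= enorm x & r1 <= enorm y].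
  by split; lra.
have xX : hyperplane s omega x.
  by rewrite /hyperplane /= dotZl divfK // gt_eqF.
have Ux : exterior Omega x by exact: HX.
have Uy : exterior Omega y.
  by apply: HX; rewrite /hyperplane /= dotDl xX Hz addr0.
set phi := (enorm y)^-1 *: y.
have phi1 : sphere phi.
  by rewrite /sphere /= enormZ ger0_norm ?invr_ge0 ?(ltW y0) // mulVf // gt_eqF.
have pt : enorm (phi - theta) <= 2 * (enorm zeta / enorm x).
  by rewrite -x_dir; exact: unit_direction_dist.
have zxr : enorm zeta / enorm x <= r^-1 by rewrite ler_pdivrMr // mulrC ler_pdivlMr // mulrC.
have pr : enorm (phi - theta) <= rho.
  apply: le_trans pt _.
  have : 2 * r^-1 <= rho.
    by rewrite ler_pdivrMr // mulrC -ler_pdivrMr.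
  lra.
have gd : cmod (f1 phi - g) <= L * (2 * (enorm zeta / enorm x)).
  by apply: le_trans (Lip _ phi1 pr) _; rewrite ler_wpM2l.
have gM : cmod g <= M by rewrite /M lerDl mulr_ge0 // ltW.
have phiM : cmod (f1 phi) <= M.
  rewrite -(subrK g (f1 phi)); apply: le_trans (cmodD _ _) _.
  rewrite addrC lerD2l; apply: le_trans (Lip _ phi1 pr) _.
  by rewrite ler_wpM2l.
pose ex := expi (kappa * enorm x - dot k x).
pose ey := expi (kappa * enorm y - dot k y).
pose ax : R[i] := ((holographic_data psi1 x k)%:C)%C.
pose ay : R[i] := ((holographic_data psi1 y k)%:C)%C.
(* [rx] and [ry1] are the expansion errors at x and y, each with its own direction; [ry2] is the
   cost of using theta instead of y/|y| in the data at y. The former make up E1, the latter E2. *)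
pose rx := ax - (ex * g + (ex * g)^*%C).
pose ry1 := ay - (ey * f1 phi + (ey * f1 phi)^*%C).
pose ry2 := ey * (f1 phi - g) + (ey * (f1 phi - g))^*%C.
have rxB : cmod rx <= B / enorm x `^ sigma R d.
  have farx := far x Ux xr1; rewrite x_dir in farx.
  exact: (holographic_expansion d_ge2 (ltW C0) M0 x1 gM farx (erefl _)).
have ryB : cmod ry1 <= B / enorm y `^ sigma R d.
  exact: (holographic_expansion d_ge2 (ltW C0) M0 y1 phiM (far y Uy yr1) (erefl _)).
have yxs := inv_powR_sigma_le d y0 x0 yx.
exists (ex^*%C * ry1 - ey^*%C * rx), (ex^*%C * ry2); split.
- have := @two_point_elimination R ex ey g ax ay rx (ry1 + ry2) (Dfun x zeta k).
  have conjD (u v : R[i]) : (u + v)^*%C = u^*%C + v^*%C by exact: rmorphD.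
  move=> -> //; first last.
  + exact: Dfun_expi.
  + by rewrite /ry1 /ry2 mulrBr rmorphB /=; ring.
  + by rewrite /rx; ring.
  rewrite /f11 -/y -/ax -/ay k_norm.
  have -> : expi (dot k y - kappa * enorm y) = ey^*%C by rewrite /ey -expiN opprB.
  have -> : expi (dot k x - kappa * enorm x) = ex^*%C by rewrite /ex -expiN opprB.
  by congr (_ + _ * _); ring.
- apply: le_trans (cmodD _ _) _; rewrite cmodN !cmodM !cmodJ !cmod_expi !mul1r.
  have : B / enorm y `^ sigma R d <= B * (2 / enorm x `^ sigma R d) by rewrite ler_wpM2l.
  have : 0 <= (4 * L + 1) / enorm x `^ sigma R d.
    by rewrite divr_ge0 ?powR_ge0 // addr_ge0 // mulr_ge0.
  move: rxB ryB; clear; lra.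
- rewrite cmodM cmodJ cmod_expi mul1r; apply: le_trans (cmodD _ _) _.
  rewrite cmodJ cmodM cmod_expi mul1r.
  have : 0 <= (3 * B + 1) * (enorm zeta / enorm x).
    by rewrite mulr_ge0 ?divr_ge0 ?enorm_ge0 // addr_ge0 // mulr_ge0.
  move: gd; clear; lra.
Qed.
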